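(* In the setting described in the context, $B$ with its algebra structure (as a subalgebra of $M_2$), the comultiplication $\Delta$, counit $\varepsilon$ and antipode $S$ defined there, is a semisimple Hopf algebra, and $A$ with its algebra structure (as a subalgebra of $M_1$) and the dual coalgebra structure and antipode defined there is a semisimple Hopf algebra; via the pairing $\langle\,,\rangle$, $A$ is the Hopf algebra dual to $B$.
   Context: $k$ is a field; $C_R(S)=\{r\in R:rs=sr\ \forall s\in S\}$. $N\subseteq M$ is a strongly separable, irreducible extension of $k$-algebras: $C_M(N)=k1$ and there are an $N$-bimodule map $E:M\to N$ and $x_1,\dots,x_n,y_1,\dots,y_n\in M$ with $\sum_iE(mx_i)y_i=m=\sum_ix_iE(y_im)$ for all $m\in M$, $E(1)\neq0$, $\sum_ix_iy_i\neq0$; normalized so that $E(1)=1$, whence $\sum_ix_iy_i=\lambda^{-1}1$ with $0\neq\lambda\in k$. Basic construction: given $S\subseteq R$, an $S$-bimodule map $E_S:R\to S$ with $E_S(1)=1$ and $r_i,s_i\in R$ with $\sum_iE_S(rr_i)s_i=r=\sum_ir_iE_S(s_ir)$ and $\sum_ir_is_i=\lambda^{-1}1$, set $R_1=R\otimes_SR$ with product $(a\otimes b)(c\otimes d)=aE_S(bc)\otimes d$, unit $\sum_ir_i\otimes s_i$, $R\subseteq R_1$ via $r\mapsto\sum_irr_i\otimes s_i$, $e=1\otimes1$, $E_R:R_1\to R$, $a\otimes b\mapsto\lambda ab$; then $E_R$, $\lambda^{-1}r_i\otimes1$, $1\otimes s_i$ satisfy the same conditions with the same $\lambda$. From $(N\subseteq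 M,E)$ get $M_1,e_1,E_M$; from $(M\subseteq M_1,E_M)$ get $M_2,e_2,E_{M_1}$. Let $A=C_{M_1}(N)$, $B=C_{M_2}(M)$, $C=C_{M_2}(N)$. Depth 2 is assumed: $M_1$ is free as right $M$-module with basis in $A$, $M_2$ free as right $M_1$-module with basis in $B$. Let $F=E_M\circ E_{M_1}$; for $c\in C$, $F(c)\in C_M(N)=k1$, identified with $k$. Define the bilinear form $\langle a,b\rangle=\lambda^{-2}F(ae_2e_1b)$ for $a\in A$, $b\in B$; it is non-degenerate. On $B$: $\Delta(b)=b_{(1)}\otimes b_{(2)}$ is determined by $\langle a,b_{(1)}\rangle\langle a',b_{(2)}\rangle=\langle aa',b\rangle$ for all $a,a'\in A$; $\varepsilon(b)=\langle1,b\rangle$; $S:B\to B$ is determined by $E_{M_1}(be_1e_2)=E_{M_1}(e_2e_1S(b))$. On $A$: $\Delta_A(a)=a_{(1)}\otimes a_{(2)}$ determined by $\langle a_{(1)},b\rangle\langle a_{(2)},b'\rangle=\langle a,bb'\rangle$, $\varepsilon_A(a)=\langle a,1\rangle$, and $S_A$ determined by $\langle S_A(a),b\rangle=\langle a,S(b)\rangle$. *)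

(* Defs.v *)
From HB Require Import structures.
From mathcomp Require Import all_boot all_order all_algebra.
Set Implicit Arguments. Unset Strict Implicit. Unset Printing Implicit Defensive.
Import GRing.Theory.
Local Open Scope ring_scope.

Section Defs.
Variables (k : fieldType) (T : algType k).

Definition is_subalg (P : T -> Prop) : Prop :=
  [/\ P 1, (forall (c : k) x y, P x -> P y -> P (c *: x + y))
         & (forall x y, P x -> P y -> P (x * y))].

Definition centralizer (P S : T -> Prop) : T -> Prop :=
  fun x => P x /\ (forall s, S s -> x * s = s * x).

(* Abstract characterization (up to isomorphism) of the basic construction
   R1 = R (x)_S R of S <= R with conditional expectation ES, index lam:
   e in R1 commutes with S, e r e = ES(r) e, r |-> r e injective on R,
   R1 = R e R, and ER(a e b) = lam a b (ER additive on R1).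
   Then a (x) b |-> a e b is an algebra isomorphism R (x)_S R ~ R1 sending
   1 (x) 1 to e, the embedding of R to itself, and E_R to ER. *)
Definition basic_construction (S R R1 : T -> Prop) (ES : T -> T) (lam : k)
    (e : T) (ER : T -> T) : Prop :=
  R1 e /\ (forall s, S s -> e * s = s * e) /\
      (forall r, R r -> e * r * e = ES r * e) /\
      (forall r, R r -> r * e = 0 -> r = 0) /\
      (forall z, R1 z -> exists p (a b : 'I_p -> T),
            (forall j, R (a j) /\ R (b j)) /\ z = \sum_(j < p) a j * e * b j) /\
      (forall a b, R a -> R b -> ER (a * e * b) = lam *: (a * b)) /\
      (forall z z', R1 z -> R1 z' -> ER (z + z') = ER z + ER z').

Definition right_free_basis_in (R R1 P : T -> Prop) : Prop :=
  exists p (u : 'I_p -> T),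
    [/\ (forall j, P (u j)),
        (forall z, R1 z -> exists m : 'I_p -> T,
              (forall j, R (m j)) /\ z = \sum_(j < p) u j * m j)
      & (forall m : 'I_p -> T, (forall j, R (m j)) ->
              \sum_(j < p) u j * m j = 0 -> forall j, m j = 0)].

Definition lin_on (H : T -> Prop) (f : T -> k) : Prop :=
  forall (c : k) x y, H x -> H y -> f (c *: x + y) = c * f x + f y.

(* Elements of H (x) H are represented by finite lists of simple tensors
   sum_j x_j (x) y_j; two representatives are equal as tensors iff all
   functionals f (x) g agree on them. *)
Definition teq2 (H : T -> Prop) (t t' : seq (T * T)) : Prop :=
  forall f g, lin_on H f -> lin_on H g ->
    \sum_(p <- t) f p.1 * g p.2 = \sum_(p <- t') f p.1 * g p.2.

Definition teq3 (H : T -> Prop) (t t' : seq (T * T * T)) : Prop :=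
  forall f g h, lin_on H f -> lin_on H g -> lin_on H h ->
    \sum_(p <- t) f p.1.1 * g p.1.2 * h p.2
    = \sum_(p <- t') f p.1.1 * g p.1.2 * h p.2.

(* H (a subalgebra of T, with T's product and unit) is a Hopf algebra with
   comultiplication D (D h a representative of Delta(h) in H (x) H),
   counit eps and antipode S. *)
Definition is_hopf (H : T -> Prop) (D : T -> seq (T * T)) (eps : T -> k)
    (S : T -> T) : Prop :=
  is_subalg H /\
      (forall h, H h -> forall p, p \in D h -> H p.1 /\ H p.2) /\
      (forall (c : k) x y, H x -> H y ->
          teq2 H (D (c *: x + y)) ([seq (c *: p.1, p.2) | p <- D x] ++ D y)) /\
      lin_on H eps /\
      (forall x, H x -> H (S x)) /\
      (forall (c : k) x y, H x -> H y -> S (c *: x + y) = c *: S x + S y) /\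
      (forall h, H h ->
         teq3 H (flatten [seq [seq (q.1, q.2, p.2) | q <- D p.1] | p <- D h])
                (flatten [seq [seq (p.1, q.1, q.2) | q <- D p.2] | p <- D h])) /\
      (forall h, H h -> \sum_(p <- D h) eps p.1 *: p.2 = h /\
                        \sum_(p <- D h) eps p.2 *: p.1 = h) /\
      teq2 H (D 1) [:: (1, 1)] /\
      (forall x y, H x -> H y ->
         teq2 H (D (x * y)) [seq (p.1 * q.1, p.2 * q.2) | p <- D x, q <- D y]) /\
      eps 1 = 1 /\ (forall x y, H x -> H y -> eps (x * y) = eps x * eps y) /\
      (forall h, H h -> \sum_(p <- D h) S p.1 * p.2 = (eps h)%:A /\
                        \sum_(p <- D h) p.1 * S p.2 = (eps h)%:A).

Definition left_ideal (H I : T -> Prop) : Prop :=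
  [/\ (forall x, I x -> H x), I 0,
      (forall (c : k) x y, I x -> I y -> I (c *: x + y))
    & (forall h x, H h -> I x -> I (h * x))].

Definition semisimple_alg (H : T -> Prop) : Prop :=
  forall I, left_ideal H I -> exists J, [/\ left_ideal H J,
      (forall x, I x -> J x -> x = 0)
    & (forall h, H h -> exists a b, [/\ I a, J b & h = a + b])].

(* <a, b> = lam^-2 F(a e2 e1 b), F = E_M o E_{M1}; values lie in k1,
   so we keep them as elements of T (of the form c%:A). *)
Definition pairing (lam : k) (EM EM1 : T -> T) (e1 e2 : T) (a b : T) : T :=
  (lam ^- 2) *: EM (EM1 (a * e2 * e1 * b)).

End Defs.

(* Main.v *)
Require Import Defs.
From HB Require Import structures.
From mathcomp Require Import all_boot all_order all_algebra.
From Stdlib Require Import Classical ClassicalEpsilon.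
Import GRing.Theory.
Local Open Scope ring_scope.

(* Let B act on M1 from the right by z o b = lam^-1 E_{M1}(e2 z b) and from the left by
   b . z = lam^-1 E_{M1}(b z e2); both are M-bimodule maps, hence determined by their value
   at e1, and every element of A is such a value. So b . z = z o S(b) for a unique S(b): this
   is the antipode, an anti-automorphism of the algebra B. Since F(z e2) = F(e2 z),
     E_M((z o b) z') = E_M(z (b . z')) = E_M(z (z' o S(b))).
   Depth 2 gives a basis u_j of B with M2 free over M1, so z b = sum_j u_j (z o w_j(b)) with
   w_j(b) in B, which is a comultiplication making M1 a right B-module algebra; applying E_M
   to (z o u_j)(z' o w_j(b)) yields one antipode identity, and the other one follows because a
   one-sided inverse of the matrix (w_i(u_j)) over the finite-dimensional algebra B is
   two-sided. The pairing satisfies <a, S(b)> = lam^-1 E_M((a o b) e1), which is multiplicative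
   in a for this comultiplication because a |-> lam^-1 E_M(a e1) is a character of A; so S
   transports the opposite structure onto the one of the statement. A is dual to B, and
   Frobenius dual bases with sum_j u_j v_j = lam^-1 give separability idempotents. *)

Set Implicit Arguments. Unset Strict Implicit. Unset Printing Implicit Defensive.

(** * Elements of [k1] and their coefficients *)

Section Scalars.
Variables (k : fieldType) (T : algType k).
Implicit Types (c : k) (z : T).

Definition is_scalar z : Prop := exists c, z = c%:A.

(** The pairing takes its values in [T]; classical choice extracts the coefficient. Off [k1] the
    value is unspecified. *)
Definition scal z : k := epsilon (inhabits 0) (fun c => z = c%:A).

Lemma scalE z : is_scalar z -> (scal z)%:A = z.
Proof. by move=> hz; rewrite {2}(epsilon_spec (inhabits 0) (fun c => z = c%:A) hz). Qed.

Lemma scalar_inj c c' : c%:A = c'%:A :> T -> c = c'.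
Proof.
move=> /eqP; rewrite -subr_eq0 -scalerBl => /eqP h; apply/eqP; rewrite -subr_eq0.
apply/eqP; case: (eqVneq (c - c') 0) => // nz.
have: (1 : T) = 0 by rewrite -(scale1r 1) -(mulVf nz) -scalerA h scaler0.
by move/eqP; rewrite oner_eq0.
Qed.

Lemma scalK c : scal c%:A = c.
Proof. by apply: scalar_inj; apply: scalE; exists c. Qed.

Lemma is_scalarZ c z : is_scalar z -> is_scalar (c *: z).
Proof. by case=> c' ->; exists (c * c'); rewrite scalerA. Qed.

Lemma scalMl z t : is_scalar z -> z * t = scal z *: t.
Proof. by move=> hz; rewrite -{1}(scalE hz) -scalerAl mul1r. Qed.

Lemma scalMr z t : is_scalar z -> t * z = scal z *: t.
Proof. by move=> hz; rewrite -{1}(scalE hz) -scalerAr mulr1. Qed.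

Lemma scal_comm z t : is_scalar z -> z * t = t * z.
Proof. by move=> hz; rewrite scalMl // scalMr. Qed.

Lemma scalM z z' : is_scalar z -> is_scalar z' -> scal (z * z') = scal z * scal z'.
Proof. by move=> hz [c ->]; rewrite (scalMl _ hz) scalerA !scalK. Qed.

Lemma scalP c z z' : is_scalar z -> is_scalar z' ->
  scal (c *: z + z') = c * scal z + scal z'.
Proof.
by case=> [a ->] [b ->]; rewrite scalerA -scalerDl !scalK.
Qed.

End Scalars.

(** * Subalgebras and centralizers *)

Section Subalgebras.
Variables (k : fieldType) (T : algType k) (P : T -> Prop).
Hypothesis hP : is_subalg P.

Lemma subalg1 : P 1. Proof. by case: hP. Qed.
Lemma subalgM x y : P x -> P y -> P (x * y). Proof. by case: hP => _ _; apply. Qed.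
Lemma subalgL c x y : P x -> P y -> P (c *: x + y).
Proof. by case: hP => _ h _; apply: h. Qed.
Lemma subalg0 : P 0.
Proof. by rewrite -(addNr 1) -scaleN1r; apply: subalgL; apply: subalg1. Qed.
Lemma subalgZ c x : P x -> P (c *: x).
Proof. by move=> h; rewrite -[_ *: _]addr0; apply: subalgL => //; apply: subalg0. Qed.
Lemma subalgA c : P c%:A. Proof. by apply/subalgZ/subalg1. Qed.
Lemma subalgD x y : P x -> P y -> P (x + y).
Proof. by move=> hx hy; rewrite -(scale1r x); apply: subalgL. Qed.
Lemma subalg_sum (I : Type) (r : seq I) (F : I -> T) :
  (forall i, P (F i)) -> P (\sum_(i <- r) F i).
Proof.
move=> h; elim/big_ind: _ => //; [exact: subalg0|exact: subalgD].
Qed.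
End Subalgebras.

Lemma subalg_full (k : fieldType) (T : algType k) : is_subalg (fun _ : T => True).
Proof. by []. Qed.

Lemma centralizer_subalg (k : fieldType) (T : algType k) (P S : T -> Prop) :
  is_subalg P -> is_subalg (centralizer P S).
Proof.
move=> hP; split.
- by split=> [|s _]; [apply: subalg1 | rewrite mul1r mulr1].
- move=> c x y [hx cx] [hy cy]; split=> [|s hs]; first exact: subalgL.
  by rewrite mulrDl mulrDr -scalerAl -scalerAr cx // cy.
- move=> x y [hx cx] [hy cy]; split=> [|s hs]; first exact: subalgM.
  by rewrite -mulrA cy // mulrA cx // mulrA.
Qed.

(** * Linear algebra over [k] in a subalgebra with a finite basis *)

Section FiniteDim.
Variables (k : fieldType) (T : algType k) (P : T -> Prop) (d : nat).
Variables (u : 'I_d -> T) (r : T -> 'rV[k]_d).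
Hypotheses (hP : is_subalg P) (hu : forall j, P (u j)).
Hypothesis hr : forall z, P z -> z = \sum_j r z 0 j *: u j.
Hypothesis rlin : forall c x y, P x -> P y -> r (c *: x + y) = c *: r x + r y.
Hypothesis rK : forall X : 'rV[k]_d, r (\sum_j X 0 j *: u j) = X.

Let vec (X : 'rV[k]_d) : T := \sum_j X 0 j *: u j.

Let vecP X : P (vec X).
Proof. by apply: subalg_sum => // j; apply: subalgZ. Qed.

Let vecL c X Y : vec (c *: X + Y) = c *: vec X + vec Y.
Proof.
rewrite /vec scaler_sumr -big_split; apply: eq_bigr => j _ /=.
by rewrite !mxE scalerDl scalerA.
Qed.

(** Rows of a matrix encode elements of [P]. A matrix of maximal rank among those with all rows in
    [I] has row space exactly [I], and multiplication by [pinvmx X *m X] projects onto it. *)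
Lemma subspace_projection (I : T -> Prop) :
  (forall x, I x -> P x) -> I 0 -> (forall (c : k) x y, I x -> I y -> I (c *: x + y)) ->
  exists pi : T -> T, [/\ (forall z, P z -> I (pi z)), (forall z, I z -> pi z = z)
    & (forall c x y, P x -> P y -> pi (c *: x + y) = c *: pi x + pi y)].
Proof.
move=> IP I0 IL.
pose rows_in (X : 'M[k]_d) := forall i, I (vec (row i X)).
pose Q n := exists2 X, rows_in X & \rank X = n.
have Q0 : Q 0.
  exists 0; last exact: mxrank0.
  by move=> i; rewrite row0 /vec big1 // => j _; rewrite mxE scale0r.
(* Ranks are bounded by [d], so a maximal one exists; [Q] is not known to be decidable, hence the
   argument by contradiction. *)
have [n [[X XI rX] nmax]] : exists n, Q n /\ forall m, Q m -> (m <= n)%N.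
  apply: NNPP => nex.
  have H m : exists2 n, Q n & (m <= n)%N.
    elim: m => [|m [n qn le]]; first by exists 0.
    apply: NNPP => h; apply: nex; exists n; split=> // m' qm'; rewrite leqNgt.
    by apply/negP => lt; apply: h; exists m' => //; apply: leq_ltn_trans lt.
  have [n [X _ rX]] := H d.+1; have := rank_leq_row X.
  by rewrite rX leqNgt => /negP h /h.
have IM (Y : 'rV_d) : I (vec (Y *m X)).
  rewrite mulmx_sum_row; elim/big_ind: _ => //.
  - by rewrite /vec big1 // => j _; rewrite mxE scale0r.
  - by move=> A B hA hB; rewrite -[A]scale1r vecL; apply: IL.
  - move=> i _; rewrite -[_ *: row i X]addr0 vecL; apply: IL => //.
    by rewrite /vec big1 // => j _; rewrite mxE scale0r.
(* Otherwise adjoining [r z] to the row space of [X] would give a larger rank. *)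
have sub z : I z -> (r z <= X)%MS.
  move=> hz; apply/negPn/negP => nsub.
  have Isum w : (w <= X + r z)%MS -> I (vec w).
    case/sub_addsmxP=> [[A B] /= ->]; rewrite -[A *m X]scale1r vecL.
    apply: (IL) => //; rewrite (mx11_scalar B) mul_scalar_mx -[_ *: _]addr0 vecL.
    apply: (IL); first by rewrite /vec -hr //; apply: IP.
    by rewrite /vec big1 // => j _; rewrite mxE scale0r.
  have /nmax : Q (\rank (X + r z)%MS).
    exists (X + r z)%MS => // i; apply: Isum; exact: row_sub.
  rewrite -rX => le; case/negP: nsub.
  have /eqmxP : (X == X + r z)%MS.
    by rewrite -(geq_leqif (mxrank_leqif_eq (addsmxSl X (r z)))).
  by move=> e; rewrite e addsmxSr.
exists (fun z => vec (r z *m pinvmx X *m X)); split.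
- by move=> z hz; apply: IM.
- by move=> z hz; rewrite mulmxKpV ?sub // /vec -hr //; apply: IP.
- by move=> c x y hx hy; rewrite rlin // !mulmxDl -!scalemxAl vecL.
Qed.

(** A square matrix over [P] acts on rows of length [m] over [P], a finite-dimensional space over
    [k] encoded by [m] by [d] matrices. For endomorphisms of that space a one-sided inverse is
    two-sided. *)
Lemma finite_dim_mulmx1C m (C D : 'I_m -> 'I_m -> T) :
  (forall i j, P (C i j)) -> (forall i j, P (D i j)) ->
  (forall i j, \sum_l C i l * D l j = (i == j)%:R) ->
  (forall i j, \sum_l D i l * C l j = (i == j)%:R).
Proof.
move=> hC hD CD.
pose act (E : 'I_m -> 'I_m -> T) (X : 'M[k]_(m, d)) : 'M[k]_(m, d) :=
  \matrix_(i, j) r (\sum_l vec (row l X) * E l i) 0 j.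
have actP E X : (forall i j, P (E i j)) ->
    forall i, vec (row i (act E X)) = \sum_l vec (row l X) * E l i.
  move=> hE i; rewrite [RHS]hr; last first.
    by apply: subalg_sum => // l; apply: subalgM.
  by apply: eq_bigr => j _; rewrite !mxE.
have vec_inj X Y : vec X = vec Y -> X = Y by move=> e; rewrite -(rK X) -/(vec X) e rK.
have act_lin E : (forall i j, P (E i j)) -> linear (act E).
  move=> hE c X Y; apply/row_matrixP => i; apply: vec_inj.
  rewrite linearP vecL !actP // scaler_sumr -big_split; apply: eq_bigr => l _ /=.
  by rewrite linearP vecL mulrDl scalerAl.
have actK : cancel (act C) (act D).
  move=> X; apply/row_matrixP => i; apply: vec_inj; rewrite actP //.
  under eq_bigr => l _ do rewrite actP // mulr_suml.
  rewrite exchange_big (bigD1 i) //=.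
  under eq_bigr => l _ do rewrite -mulrA.
  rewrite -mulr_sumr CD eqxx mulr1 big1 ?addr0 // => l nl.
  under eq_bigr => l' _ do rewrite -mulrA.
  by rewrite -mulr_sumr CD (negbTE nl) mulr0.
pose fC : {linear _ -> _} := HB.pack (act C) (GRing.isLinear.Build _ _ _ _ (act C) (act_lin C hC)).
pose fD : {linear _ -> _} := HB.pack (act D) (GRing.isLinear.Build _ _ _ _ (act D) (act_lin D hD)).
have eCD : lin_mx fC *m lin_mx fD = 1%:M.
  apply/row_matrixP => i; rewrite !rowE mulmxA mulmx1.
  by rewrite -[delta_mx 0 i]vec_mxK !mul_vec_lin; congr mxvec; apply: actK.
have actK' : cancel (act D) (act C).
  move=> X; apply: (can_inj mxvecK).
  by rewrite -(mul_vec_lin fC) -(mul_vec_lin fD) -mulmxA (mulmx1C eCD) mulmx1.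
(* Evaluating on the [i]-th unit row recovers the entries of the product. *)
move=> i j.
pose X : 'M[k]_(m, d) := \matrix_(l, t) (r (l == i)%:R 0 t).
have hX l : vec (row l X) = (l == i)%:R.
  rewrite [RHS]hr; first by apply: eq_bigr => t _; rewrite !mxE.
  by case: (l == i); [apply: subalg1 | apply: subalg0].
have := hX j; rewrite -{1}(actK' X) actP // eq_sym => <-.
apply: eq_bigr => l _; rewrite actP // (bigD1 i) //= hX eqxx mul1r big1 ?addr0 //.
by move=> l' nl; rewrite hX (negbTE nl) mul0r.
Qed.

End FiniteDim.

(** * Frobenius extensions with a normalized expectation and an index, the data shared by all levels
    of the tower *)

Record frobenius (k : fieldType) (T : algType k) (S R : T -> Prop) (E : T -> T)
    (lam : k) n (x y : 'I_n -> T) : Prop := Frobenius {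
  frob_S : is_subalg S;
  frob_R : is_subalg R;
  frob_SR : forall s, S s -> R s;
  frob_E : forall r, R r -> S (E r);
  frob_add : forall r r', R r -> R r' -> E (r + r') = E r + E r';
  frob_bimod : forall s r s', S s -> R r -> S s' -> E (s * r * s') = s * E r * s';
  frob_x : forall i, R (x i);
  frob_y : forall i, R (y i);
  frob_l : forall r, R r -> \sum_i E (r * x i) * y i = r;
  frob_r : forall r, R r -> \sum_i x i * E (y i * r) = r;
  frob_E1 : E 1 = 1;
  frob_index : \sum_i x i * y i = lam^-1%:A
}.

Section Frobenius.
Variables (k : fieldType) (T : algType k) (S R : T -> Prop) (E : T -> T).
Variables (lam : k) (n : nat) (x y : 'I_n -> T).
Hypothesis fr : frobenius S R E lam x y.

Let hS := frob_S fr.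
Let hR := frob_R fr.

Lemma frobMl s r : S s -> R r -> E (s * r) = s * E r.
Proof.
by move=> hs hr; rewrite -[s * r]mulr1 (frob_bimod fr) ?mulr1 //; apply: subalg1.
Qed.

Lemma frobMr s r : S s -> R r -> E (r * s) = E r * s.
Proof.
by move=> hs hr; rewrite -[r]mul1r (frob_bimod fr) ?mul1r //; apply: subalg1.
Qed.

Lemma frobZ c r : R r -> E (c *: r) = c *: E r.
Proof.
move=> hr; rewrite -{1}(mul1r r) scalerAl frobMl //; last exact: (subalgA hS).
by rewrite -scalerAl mul1r.
Qed.

Lemma frobL c r r' : R r -> R r' -> E (c *: r + r') = c *: E r + E r'.
Proof. by move=> hr hr'; rewrite (frob_add fr) ?frobZ //; apply: subalgZ. Qed.

Lemma frob_sum I (s : seq I) (F : I -> T) : (forall i, R (F i)) ->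
  E (\sum_(i <- s) F i) = \sum_(i <- s) E (F i).
Proof.
move=> hF; elim: s => [|i s IH]; last first.
  by rewrite !big_cons (frob_add fr) ?IH //; apply: subalg_sum.
by rewrite !big_nil -(scale0r 1) frobZ ?scale0r //; apply: subalg1.
Qed.

Lemma frob_nondegl r : R r -> (forall i, E (r * x i) = 0) -> r = 0.
Proof.
by move=> hr h; rewrite -(frob_l fr hr) big1 // => i _; rewrite h mul0r.
Qed.

Lemma frob_nondegr r : R r -> (forall i, E (y i * r) = 0) -> r = 0.
Proof.
by move=> hr h; rewrite -(frob_r fr hr) big1 // => i _; rewrite h mulr0.
Qed.

End Frobenius.

(** * The basic construction as one step of the tower *)

Section BasicConstruction.
Variables (k : fieldType) (T : algType k) (S R R1 : T -> Prop) (E : T -> T).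
Variables (lam : k) (n : nat) (x y : 'I_n -> T) (e : T) (E1 : T -> T).
Hypotheses (fr : frobenius S R E lam x y) (hlam : lam != 0).
Hypotheses (hR1 : is_subalg R1) (hRR1 : forall r, R r -> R1 r).
Hypothesis hbc : basic_construction S R R1 E lam e E1.

Let hS := frob_S fr.
Let hR := frob_R fr.

Lemma bc_e : R1 e. Proof. by case: hbc. Qed.
Lemma bc_comm s : S s -> e * s = s * e.
Proof. by case: hbc => _ [h _]; apply: h. Qed.
Lemma bc_ere r : R r -> e * r * e = E r * e.
Proof. by case: hbc => _ [_ [h _]]; apply: h. Qed.
Lemma bc_span z : R1 z -> exists p (a b : 'I_p -> T),
  (forall j, R (a j) /\ R (b j)) /\ z = \sum_(j < p) a j * e * b j.
Proof. by case: hbc => _ [_ [_ [_ [h _]]]]; apply: h. Qed.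
Lemma bc_E1 a b : R a -> R b -> E1 (a * e * b) = lam *: (a * b).
Proof. by case: hbc => _ [_ [_ [_ [_ [h _]]]]]; apply: h. Qed.
Lemma bc_add z z' : R1 z -> R1 z' -> E1 (z + z') = E1 z + E1 z'.
Proof. by case: hbc => _ [_ [_ [_ [_ [_ h]]]]]; apply: h. Qed.

Lemma bc_ee : e * e = e.
Proof.
by rewrite -{1}[e]mulr1 bc_ere ?(frob_E1 fr) ?mul1r //; apply: subalg1.
Qed.

Lemma bc_in a b : R a -> R b -> R1 (a * e * b).
Proof.
have he := bc_e.
by move=> ha hb; apply: subalgM; auto; apply: subalgM; auto.
Qed.

Lemma bc_ind (Q : T -> Prop) :
  (forall a b, R a -> R b -> Q (a * e * b)) ->
  (forall z z', R1 z -> R1 z' -> Q z -> Q z' -> Q (z + z')) ->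
  forall z, R1 z -> Q z.
Proof.
move=> h1 h2 z /bc_span [p [a [b [hab ->]]]].
suff [] : R1 (\sum_(j < p) a j * e * b j) /\ Q (\sum_(j < p) a j * e * b j) by [].
elim/big_ind: _ => [|u v [hu qu] [hv qv]|j _].
(* The empty sum is written [0 * e * 0], so the first hypothesis covers it. *)
- have h0 := subalg0 hR.
  rewrite -(mul0r 0) -[X in X * _](mul0r e).
  by split; [apply: bc_in|apply: h1].
- by split; [apply: subalgD|apply: h2].
- by case: (hab j) => ha hb; split; [apply: bc_in|apply: h1].
Qed.

(** Since [e] generates [R1] as an [R]-bimodule, identities between bimodule maps on [M1] can later
    be checked at [e1] alone. *)
Lemma bc_bimod_ext (f g : T -> T) :
  (forall a b, R a -> R b -> f (a * e * b) = a * f e * b) ->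
  (forall a b, R a -> R b -> g (a * e * b) = a * g e * b) ->
  (forall z z', R1 z -> R1 z' -> f (z + z') = f z + f z') ->
  (forall z z', R1 z -> R1 z' -> g (z + z') = g z + g z') ->
  f e = g e -> forall z, R1 z -> f z = g z.
Proof.
move=> fb gb fa ga fg; apply: bc_ind => [a b ha hb|z z' hz hz' e1 e2].
  by rewrite fb // gb // fg.
by rewrite fa // ga // e1 e2.
Qed.

(** By [frob_r] and [e * r * e = E r * e], left multiplication by the sum fixes every [a * e * b];
    it is then applied to 1. *)
Lemma bc_unit : \sum_i x i * e * y i = 1.
Proof.
suff h z : R1 z -> (\sum_i x i * e * y i) * z = z.
  by rewrite -[LHS]mulr1 h //; apply: subalg1.
move: z; apply: bc_ind => [a b ha hb|z z' _ _ h h']; last by rewrite mulrDr h h'.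
rewrite mulr_suml -{2}(frob_r fr ha) !mulr_suml; apply: eq_bigr => i _.
rewrite !mulrA -[in LHS](mulrA (x i * e)) -[in LHS](mulrA (x i)) mulrA.
have hya : R (y i * a) by apply: subalgM => //; apply: (frob_y fr).
by rewrite -[x i * e * (y i * a) * e]mulrA -(mulrA (x i)) (mulrA e) bc_ere // !mulrA.
Qed.

(** The index is unchanged, so the construction iterates. The factor [lam^-1] in the first dual
    basis cancels the [lam] of [bc_E1]. *)
Lemma bc_frobenius :
  frobenius R R1 E1 lam (fun i => lam^-1 *: (x i * e)) (fun i => e * y i).
Proof.
have R1E z : R1 z -> R (E1 z).
  move: z; apply: bc_ind => [a b ha hb|z z' hz hz' r r'].
    by rewrite bc_E1 //; apply: subalgZ => //; apply: subalgM.
  by rewrite bc_add //; apply: subalgD.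
have hx := frob_x fr; have hy := frob_y fr; have h1 := subalg1 hR.
have bimod s r s' : R s -> R1 r -> R s' -> E1 (s * r * s') = s * E1 r * s'.
  move=> hs hr hs'; move: r hr; apply: bc_ind => [a b ha hb|z z' hz hz' q q'].
    rewrite (mulrA s) (mulrA s) -(mulrA _ b) !bc_E1 //; try exact: subalgM.
    by rewrite -scalerAr -scalerAl !mulrA.
  have hm t : R1 t -> R1 (s * t * s').
    by move=> ht; apply: subalgM; auto; apply: subalgM; auto.
  by rewrite mulrDr mulrDl !bc_add ?q ?q' ?mulrDr ?mulrDl //; apply: hm.
have hf i : R1 (lam^-1 *: (x i * e)).
  by apply: subalgZ => //; apply: subalgM; auto; apply: bc_e.
have hg i : R1 (e * y i) by apply: subalgM; auto; apply: bc_e.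
split=> //.
- exact: bc_add.
- apply: bc_ind => [a b ha hb|z z' hz hz' q q'].
    rewrite -{2}(frob_l fr hb) mulr_sumr; apply: eq_bigr => i _.
    have hbx : R (b * x i) by apply: subalgM.
    have hEbx := frob_E fr hbx; have hEbx' := frob_SR fr hEbx.
    have -> : a * e * b * (lam^-1 *: (x i * e)) = lam^-1 *: (a * E (b * x i)) * e * 1.
      by rewrite mulr1 -scalerAr -scalerAl -!mulrA -bc_ere // !mulrA.
    rewrite bc_E1 //; last by apply: subalgZ => //; apply: subalgM.
    by rewrite mulr1 scalerA divff // scale1r !mulrA -(mulrA a) -bc_comm // !mulrA.
  rewrite -[in RHS]q -[in RHS]q' -big_split; apply: eq_bigr => i _ /=.
  by rewrite mulrDl bc_add ?mulrDl //; apply: subalgM.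
- apply: bc_ind => [a b ha hb|z z' hz hz' q q'].
    rewrite -{2}(frob_r fr ha) !mulr_suml; apply: eq_bigr => i _.
    have hya : R (y i * a) by apply: subalgM.
    have hEya := frob_E fr hya; have hEya' := frob_SR fr hEya.
    have -> : e * y i * (a * e * b) = E (y i * a) * e * b.
      by rewrite -bc_ere // !mulrA.
    rewrite bc_E1 // -scalerAl -scalerAr scalerA mulVf // scale1r.
    by rewrite !mulrA -(mulrA (x i) e) bc_comm // !mulrA.
  rewrite -[in RHS]q -[in RHS]q' -big_split; apply: eq_bigr => i _ /=.
  by rewrite mulrDr bc_add ?mulrDr //; apply: subalgM.
(* [E1 1] is computed on the expression of [1] given by [bc_unit]; the index relation turns the
   result into [lam * lam^-1]. *)
- rewrite -bc_unit.
  have hb i : R1 (x i * e * y i) by apply: bc_in.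
  have E1_0 : E1 0 = 0.
    have h0 := subalg0 hR.
    by rewrite -{1}(mul0r 0) -[X in X * _](mul0r e) bc_E1 // mul0r scaler0.
  transitivity (\sum_i E1 (x i * e * y i)).
    elim: (index_enum _) => [|i s IH]; first by rewrite !big_nil.
    by rewrite !big_cons bc_add ?IH //; apply: subalg_sum.
  under eq_bigr => i _ do rewrite bc_E1 //.
  by rewrite -scaler_sumr (frob_index fr) scalerA divff // scale1r bc_unit.
- under eq_bigr => i _ do rewrite -scalerAl mulrA -(mulrA (x i)) bc_ee.
  by rewrite -scaler_sumr bc_unit.
Qed.

(** On [a * e * b] both sides equal [lam *: (E a * e * b)]. This and its mirror [bc_E1e] make the
    two actions of [B] on [M1] associative. *)
Lemma bc_eE1 z : R1 z -> e * E1 (e * z) = lam *: (e * z).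
Proof.
have h1 := subalg1 hR.
move: z; apply: bc_ind => [a b ha hb|z z' hz hz' q q'].
  have hE := frob_E fr ha; have hE' := frob_SR fr hE.
  rewrite -!mulrA (mulrA e a) (mulrA (e * a)) bc_ere // bc_E1 // -scalerAr.
  by rewrite mulrA bc_comm // mulrA.
by rewrite mulrDr bc_add ?mulrDr ?scalerDr ?q ?q' //; apply: subalgM => //; apply: bc_e.
Qed.

Lemma bc_E1e z : R1 z -> E1 (z * e) * e = lam *: (z * e).
Proof.
have h1 := subalg1 hR.
move: z; apply: bc_ind => [a b ha hb|z z' hz hz' q q'].
  have hE := frob_E fr hb; have hE' := frob_SR fr hE.
  have -> : a * e * b * e = a * E b * e * 1.
    by rewrite mulr1 -!mulrA (mulrA e) bc_ere.
  by rewrite bc_E1 // ?mulr1 -?scalerAl //; apply: subalgM.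
by rewrite mulrDl bc_add ?mulrDl ?scalerDr ?q ?q' //; apply: subalgM => //; apply: bc_e.
Qed.

(* Both sides send [a e c] to [lam E(a) E(c)]. *)
Lemma bc_trace_e z : R1 z -> E (E1 (z * e)) = E (E1 (e * z)).
Proof.
have h1 := subalg1 hR.
move: z; apply: bc_ind => [a b ha hb|z z' hz hz' q q'].
  have hE := frob_E fr hb; have hE' := frob_SR fr hE.
  have hF := frob_E fr ha; have hF' := frob_SR fr hF.
  have -> : a * e * b * e = a * E b * e * 1.
    by rewrite mulr1 -!mulrA (mulrA e) bc_ere.
  have -> : e * (a * e * b) = E a * e * b by rewrite -bc_ere // !mulrA.
  rewrite !bc_E1 // ?mulr1 ?(frobZ fr); try exact: subalgM.
  by rewrite (frobMr fr) // (frobMl fr).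
have he := bc_e.
rewrite mulrDl mulrDr !bc_add ?(frob_add fr) ?q ?q' //; try exact: subalgM.
all: by apply: (frob_E bc_frobenius); apply: subalgM.
Qed.

(** For [z] commuting with [R], [E1 (z * e)] commutes with [S], hence is a scalar [c]; expanding [z]
    in the dual bases of [bc_frobenius] then gives the scalar [lam^-1 * c]. *)
Lemma bc_irreducible :
  (forall m, centralizer R S m -> is_scalar m) ->
  forall z, centralizer R1 R z -> is_scalar z.
Proof.
move=> irr z [hz cz]; have fr1 := bc_frobenius; have he := bc_e.
have hze : R1 (z * e) by apply: subalgM.
have [|c hc] := irr (E1 (z * e)).
  split=> [|s hs]; first exact: (frob_E fr1).
  have hs' := frob_SR fr hs.
  by rewrite -(frobMr fr1) // -(frobMl fr1) // mulrA -cz // -!mulrA bc_comm.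
exists (lam^-1 * c).
rewrite -(frob_l fr1 hz) -bc_unit scaler_sumr; apply: eq_bigr => i _.
have hx := frob_x fr i.
have -> : z * (lam^-1 *: (x i * e)) = lam^-1 *: (x i * (z * e)).
  by rewrite -scalerAr !mulrA cz.
rewrite (frobZ fr1) ?(frobMl fr1 hx hze) ?hc; last by apply: subalgM; auto.
by rewrite -scalerAr mulr1 scalerA -scalerAl mulrA.
Qed.

End BasicConstruction.

(** * Dual bases of a centralizer under depth 2 *)

Record centralizer_basis (k : fieldType) (T : algType k) (P R1 : T -> Prop)
    (E : T -> T) (lam : k) d (u v : 'I_d -> T) : Prop := CentralizerBasis {
  cb_u : forall j, P (u j);
  cb_v : forall j, P (v j);
  cb_scalar : forall b, P b -> is_scalar (E b);
  cb_dual : forall i j, E (v i * u j) = (i == j)%:R;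
  cb_l : forall z, R1 z -> \sum_j u j * E (v j * z) = z;
  cb_r : forall b, P b -> \sum_j E (b * u j) * v j = b;
  cb_index : \sum_j u j * v j = lam^-1%:A
}.

Section CentralizerBasis.
Variables (k : fieldType) (T : algType k) (S R R1 : T -> Prop) (E : T -> T).
Variables (lam : k) (n : nat) (x y : 'I_n -> T).
Hypotheses (fr : frobenius R R1 E lam x y) (hSR : forall s, S s -> R s).
Hypothesis irr : forall m, centralizer R S m -> is_scalar m.
Let P := centralizer R1 S.

Let hR := frob_S fr.
Let hR1 := frob_R fr.

Let P_subalg : is_subalg P := centralizer_subalg _ hR1.

Lemma frob_centralizer_scalar b : P b -> is_scalar (E b).
Proof.
move=> [hb cb]; apply: irr; split=> [|s hs]; first exact: (frob_E fr).
by rewrite -(frobMr fr) -?(frobMl fr) ?cb //; apply: hSR.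
Qed.

(** The Gram matrix of the free basis [u] under [E] has scalar entries and is invertible; [v] is the
    dual basis read off its inverse. *)
Lemma frob_centralizer_basis : right_free_basis_in R R1 P ->
  exists d (u v : 'I_d -> T), centralizer_basis P R1 E lam u v.
Proof.
move=> [d [u [hu hspan hfree]]].
have hu1 j : R1 (u j) by case: (hu j).
have huu i j : P (u i * u j) by apply: subalgM.
pose G : 'M[k]_d := \matrix_(i, j) scal (E (u i * u j)).
have GE i j : E (u i * u j) = (G i j)%:A.
  by rewrite mxE scalE //; apply: frob_centralizer_scalar.
pose vec (c : 'rV[k]_d) : T := \sum_j c 0 j *: u j.
have hvec c : P (vec c) by apply: subalg_sum => // j; apply: subalgZ.
have vecG c j : E (vec c * u j) = ((c *m G) 0 j)%:A.
  rewrite mulr_suml (frob_sum fr) => [|i].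
    rewrite mxE scaler_suml; apply: eq_bigr => i _.
    by rewrite -scalerAl (frobZ fr) ?GE ?scalerA //; case: (huu i j).
  by apply: subalgM; auto; apply: subalgZ; auto.
(* A row [c] with [c *m G = 0] gives an element orthogonal to all [u j], hence to [R1], which they
   span over [R]. It vanishes by non-degeneracy, and then [c] vanishes by freeness. *)
have Gunit : G \in unitmx.
  rewrite -row_free_unit -kermx_eq0; apply/eqP/row_matrixP => i.
  set c := row i _; have cG : c *m G = 0 by apply/sub_kermxP; apply: row_sub.
  have c0 : vec c = 0.
    apply: (frob_nondegl fr) => [|l]; first by case: (hvec c).
    have [m [hm ->]] := hspan _ (frob_x fr l).
    rewrite mulr_sumr (frob_sum fr) => [|j].
      rewrite big1 // => j _; rewrite mulrA (frobMr fr) ?vecG ?cG ?mxE ?scale0r ?mul0r //.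
      by apply: subalgM; auto; case: (hvec c).
    apply: subalgM; auto; first by case: (hvec c).
    by apply: subalgM; auto; apply: (frob_SR fr).
  rewrite row0; apply/rowP => j; rewrite [RHS]mxE; apply: (@scalar_inj _ T).
  rewrite scale0r; apply: (hfree (fun j => (c 0 j)%:A)); first by move=> j'; apply: subalgA.
  by rewrite -[RHS]c0; apply: eq_bigr => j' _; rewrite -scalerAr mulr1.
pose v i := vec (row i (invmx G)).
have hv j : P (v j) by apply: hvec.
have hv1 j : R1 (v j) by case: (hv j).
have dual i j : E (v i * u j) = (i == j)%:R.
  by rewrite vecG -row_mul mulVmx // !mxE; case: (_ == _); rewrite ?scale1r ?scale0r.
have coef (m : 'I_d -> T) i : (forall j, R (m j)) -> E (v i * \sum_j u j * m j) = m i.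
  move=> hm; rewrite mulr_sumr (frob_sum fr) => [|j]; last first.
    by apply: subalgM; auto; apply: subalgM; auto; apply: (frob_SR fr).
  rewrite (bigD1 i) //= mulrA (frobMr fr) ?dual ?eqxx ?mul1r; auto; last exact: subalgM.
  rewrite big1 ?addr0 // => j nj; rewrite mulrA (frobMr fr); auto; last exact: subalgM.
  by rewrite dual eq_sym (negbTE nj) mul0r.
have expand z : R1 z -> \sum_j u j * E (v j * z) = z.
  move=> /hspan [m [hm ->]]; apply: eq_bigr => j _; by rewrite coef.
exists d, u, v; split=> //; first exact: frob_centralizer_scalar.
(* With [b = vec c], the scalars [E (b * u j)] are the entries of [c *m G], and the rows of
   [invmx G] that define [v] undo [G]. *)
- move=> b hb; pose c : 'rV[k]_d := \row_j scal (E (v j * b)).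
  have bE : b = vec c.
    rewrite -{1}(expand b); last by case: hb.
    apply: eq_bigr => j _; rewrite mxE -scalMr //.
    by apply: frob_centralizer_scalar; apply: subalgM.
  transitivity (\sum_j \sum_l (c *m G) 0 j *: (row j (invmx G) 0 l *: u l)).
    by apply: eq_bigr => j _; rewrite -scaler_sumr bE vecG -scalerAl mul1r.
  rewrite exchange_big bE; apply: eq_bigr => l _ /=.
  under eq_bigr => j _ do rewrite scalerA.
  rewrite -scaler_suml; congr (_ *: _).
  under eq_bigr => j _ do rewrite [row j _ 0 l]mxE.
  by rewrite -{2}(mulmxK Gunit c) [RHS]mxE.
(* Expanding each [v j] in the Frobenius dual bases and recollecting each [x i] by [expand] turns
   the sum into that of the [x i * y i]. *)
- rewrite -(frob_index fr).
  transitivity (\sum_j \sum_i u j * (E (v j * x i) * y i)).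
    by apply: eq_bigr => j _; rewrite -mulr_sumr (frob_l fr).
  rewrite exchange_big; apply: eq_bigr => i _ /=.
  under eq_bigr => j _ do rewrite mulrA.
  by rewrite -mulr_suml expand //; apply: (frob_x fr).
Qed.

End CentralizerBasis.

(** * Semisimplicity by averaging over dual bases *)

Section Semisimple.
Variables (k : fieldType) (T : algType k) (S R R1 : T -> Prop) (E : T -> T).
Variables (lam : k) (n : nat) (x y : 'I_n -> T) (d : nat) (u v : 'I_d -> T).
Hypotheses (hlam : lam != 0) (fr : frobenius R R1 E lam x y).
Let P := centralizer R1 S.
Hypothesis cb : centralizer_basis P R1 E lam u v.

Let hP : is_subalg P := centralizer_subalg _ (frob_R fr).

Definition cb_coord z : 'rV[k]_d := \row_j scal (E (v j * z)).

Lemma cb_coordE z : P z -> z = \sum_j cb_coord z 0 j *: u j.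
Proof.
move=> hz; rewrite -{1}(cb_l cb (proj1 hz)); apply: eq_bigr => j _.
by rewrite mxE scalMr //; apply: (cb_scalar cb); apply: subalgM => //; apply: (cb_v cb).
Qed.

Lemma cb_coordL c a b : P a -> P b -> cb_coord (c *: a + b) = c *: cb_coord a + cb_coord b.
Proof.
move=> ha hb; apply/rowP => j; have hv := cb_v cb j.
have hva : P (v j * a) by apply: subalgM.
have hvb : P (v j * b) by apply: subalgM.
rewrite !mxE mulrDr -scalerAr (frobL fr); [|by case: hva|by case: hvb].
by rewrite scalP //; apply: (cb_scalar cb).
Qed.

Lemma cb_coordK (X : 'rV[k]_d) : cb_coord (\sum_j X 0 j *: u j) = X.
Proof.
have hv j := cb_v cb j; have hu j := cb_u cb j.
have hvu i j : R1 (v i * u j) by case: (subalgM hP (hv i) (hu j)).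
apply/rowP => i; rewrite mxE mulr_sumr (frob_sum fr) => [|j]; last first.
  by rewrite -scalerAr; apply: (subalgZ (frob_R fr)).
rewrite (bigD1 i) //= big1 => [|j nj].
  by rewrite -scalerAr (frobZ fr) // (cb_dual cb) eqxx addr0 scalK.
by rewrite -scalerAr (frobZ fr) // (cb_dual cb) eq_sym (negbTE nj) scaler0.
Qed.

(* [lam * sum_j u_j (x) v_j] is a separability idempotent of [P]. *)
Lemma cb_semisimple : semisimple_alg P.
Proof.
move=> I [IP I0 IL IM].
have hv j := cb_v cb j; have hu j := cb_u cb j.
have [pi [piI piK piL]] := subspace_projection cb_coordE cb_coordL IP I0 IL.
have pi0 : pi 0 = 0 by apply: piK.
have piS (J : Type) (s : seq J) (c : J -> k) (F : J -> T) : (forall j, P (F j)) ->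
    pi (\sum_(j <- s) c j *: F j) = \sum_(j <- s) c j *: pi (F j).
  move=> hF; elim: s => [|j s IH]; first by rewrite !big_nil.
  by rewrite !big_cons piL ?IH //; apply: subalg_sum => // l; apply: subalgZ.
(* Averaging the [k]-linear projection makes it [P]-linear, while [cb_index] keeps it the identity
   on [I]. *)
pose Pi h := lam *: \sum_j u j * pi (v j * h).
have PiI h : P h -> I (Pi h).
  move=> hh; rewrite -[Pi h]addr0; apply: (IL) => //.
  elim/big_ind: _ => // [a b ha hb|j _]; first by rewrite -[a]scale1r; apply: IL.
  by apply: IM => //; apply: piI; apply: subalgM.
have PiK h : I h -> Pi h = h.
  move=> hh; rewrite /Pi.
  have e j : u j * pi (v j * h) = u j * v j * h by rewrite piK ?mulrA //; apply: IM.
  under eq_bigr => j _ do rewrite e.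
  by rewrite -mulr_suml (cb_index cb) -scalerAl mul1r scalerA divff // scale1r.
have PiL c a b : P a -> P b -> Pi (c *: a + b) = c *: Pi a + Pi b.
  move=> ha hb; rewrite scalerA mulrC -scalerA -scalerDr scaler_sumr -big_split.
  congr (_ *: _); apply: eq_bigr => j _ /=.
  by rewrite mulrDr -scalerAr piL ?mulrDr -?scalerAr //; apply: subalgM.
(* The tensor with legs [u j] and [v j] is a Casimir element of [P]: [v j * b] is expanded by
   [cb_r], and its coefficients are collected on the left by [cb_l] into [b * u l]. *)
have PiM b h : P b -> P h -> Pi (b * h) = b * Pi h.
  move=> hb hh; rewrite /Pi -scalerAr; congr (_ *: _).
  have hvbu j l : is_scalar (E (v j * b * u l)).
    by apply: (cb_scalar cb); apply: subalgM => //; apply: subalgM.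
  transitivity (\sum_j \sum_l (u j * E (v j * b * u l)) * pi (v l * h)).
    apply: eq_bigr => j _.
    have -> : v j * (b * h) = \sum_l scal (E (v j * b * u l)) *: (v l * h).
      rewrite mulrA -{1}(cb_r cb (subalgM hP (hv j) hb)) mulr_suml.
      by apply: eq_bigr => l _; rewrite -mulrA scalMl.
    rewrite piS => [|l]; last exact: subalgM.
    by rewrite mulr_sumr; apply: eq_bigr => l _; rewrite -[RHS]mulrA (scalMl _ (hvbu j l)).
  rewrite exchange_big mulr_sumr; apply: eq_bigr => l _ /=.
  rewrite -mulr_suml mulrA; congr (_ * _).
  under eq_bigr => j _ do rewrite -mulrA.
  by apply: (cb_l cb); case: (subalgM hP hb (hu l)).
exists (fun h => P h /\ Pi h = 0); split.
- split=> [z []//||c a b [ha a0] [hb b0]|b a hb [ha a0]].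
  + by split; [apply: subalg0|apply: PiK].
  + by split; [apply: subalgL|rewrite PiL // a0 b0 scaler0 addr0].
  + by split; [apply: subalgM|rewrite PiM // a0 mulr0].
- by move=> z hz [_ <-]; rewrite PiK.
- move=> h hh; exists (Pi h), (h - Pi h); split; [exact: PiI| |by rewrite addrC subrK].
  have hPi : P (Pi h) by apply/IP/PiI.
  rewrite addrC -scaleN1r; split; first exact: subalgL.
  by rewrite PiL // (PiK (Pi h)) ?scaleN1r ?addNr //; apply: PiI.
Qed.

End Semisimple.

(** * Linear functionals on a subalgebra *)

Section LinOn.
Variables (k : fieldType) (T : algType k) (P : T -> Prop) (f : T -> k).
Hypotheses (hP : is_subalg P) (hf : lin_on P f).

Lemma lin_on0 : f 0 = 0.
Proof.
by have h0 := subalg0 hP; rewrite -[X in f X](addNr 0) -scaleN1r hf // mulN1r addNr.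
Qed.

Lemma lin_onZ c x : P x -> f (c *: x) = c * f x.
Proof. by move=> hx; rewrite -[c *: x]addr0 hf ?lin_on0 ?addr0 //; apply: subalg0. Qed.

Lemma lin_on_sum (I : eqType) (s : seq I) (F : I -> T) : (forall i, i \in s -> P (F i)) ->
  f (\sum_(i <- s) F i) = \sum_(i <- s) f (F i).
Proof.
move=> hF; rewrite big_seq [RHS]big_seq.
suff [] : P (\sum_(i <- s | i \in s) F i) /\
  f (\sum_(i <- s | i \in s) F i) = \sum_(i <- s | i \in s) f (F i) by [].
apply: (big_rec2 (fun z t => P z /\ f z = t)).
  by rewrite lin_on0; split=> //; apply: subalg0.
move=> i t z hi [hz <-]; have h := hF i hi.
by split; [apply: subalgD|rewrite -[F i]scale1r hf // scale1r mul1r].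
Qed.

Lemma lin_on_lincomb (I : eqType) (s : seq I) (c : I -> k) (F : I -> T) :
  (forall i, i \in s -> P (F i)) ->
  f (\sum_(i <- s) c i *: F i) = \sum_(i <- s) c i * f (F i).
Proof.
move=> hF; rewrite lin_on_sum => [|i hi]; last by apply: (subalgZ hP); apply: hF.
by apply: eq_big_seq => i hi; rewrite lin_onZ //; apply: hF.
Qed.

End LinOn.

(** * Hopf algebra axioms tested through a pairing *)

Section HopfOfPairing.
Variables (k : fieldType) (T : algType k) (K H : T -> Prop) (p : T -> T -> k).
Variables (d : nat) (al be : 'I_d -> T).
Hypotheses (hK : is_subalg K) (hH : is_subalg H).
Hypotheses (hal : forall i, K (al i)) (hbe : forall i, H (be i)).
Hypothesis pLr : forall c a h h', K a -> H h -> H h' ->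
  p a (c *: h + h') = c * p a h + p a h'.
Hypothesis expand : forall h, H h -> \sum_i p (al i) h *: be i = h.

Let lin_p a : K a -> lin_on H (p a).
Proof. by move=> ha c h h' hh hh'; apply: pLr. Qed.

Lemma pairing_ext h h' : H h -> H h' -> (forall a, K a -> p a h = p a h') -> h = h'.
Proof.
by move=> hh hh' e; rewrite -(expand hh) -(expand hh'); apply: eq_bigr => i _; rewrite e.
Qed.

Lemma lin_on_pairing f h : lin_on H f -> H h -> f h = \sum_i p (al i) h * f (be i).
Proof.
by move=> hf hh; rewrite -{1}(expand hh) (lin_on_lincomb hH hf).
Qed.

(** By [expand] the functionals [p (al i)] span the dual of [H], so pairings with [K] separate
    tensors. *)
Lemma teq2_pairing (t t' : seq (T * T)) :
  (forall q, q \in t -> H q.1 /\ H q.2) -> (forall q, q \in t' -> H q.1 /\ H q.2) ->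
  (forall a a', K a -> K a' -> \sum_(q <- t) p a q.1 * p a' q.2 =
                               \sum_(q <- t') p a q.1 * p a' q.2) ->
  teq2 H t t'.
Proof.
move=> ht ht' e f g hf hg.
have expn s : (forall q, q \in s -> H q.1 /\ H q.2) ->
    \sum_(q <- s) f q.1 * g q.2 =
    \sum_i \sum_j (\sum_(q <- s) p (al i) q.1 * p (al j) q.2) * (f (be i) * g (be j)).
  move=> hs; transitivity (\sum_(q <- s) \sum_i \sum_j
      p (al i) q.1 * p (al j) q.2 * (f (be i) * g (be j))).
    apply: eq_big_seq => q /hs [h1 h2] /=.
    rewrite (lin_on_pairing hf h1) (lin_on_pairing hg h2) big_distrlr /=.
    by apply: eq_bigr => i _; apply: eq_bigr => j _; rewrite mulrACA.
  rewrite exchange_big; apply: eq_bigr => i _; rewrite exchange_big.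
  by apply: eq_bigr => j _; rewrite mulr_suml.
rewrite !expn //; apply: eq_bigr => i _; apply: eq_bigr => j _; by rewrite e.
Qed.

Lemma teq3_pairing (t t' : seq (T * T * T)) :
  (forall q, q \in t -> [/\ H q.1.1, H q.1.2 & H q.2]) ->
  (forall q, q \in t' -> [/\ H q.1.1, H q.1.2 & H q.2]) ->
  (forall a a' a'', K a -> K a' -> K a'' ->
    \sum_(q <- t) p a q.1.1 * p a' q.1.2 * p a'' q.2 =
    \sum_(q <- t') p a q.1.1 * p a' q.1.2 * p a'' q.2) ->
  teq3 H t t'.
Proof.
move=> ht ht' e f g h hf hg hh.
have expn s : (forall q, q \in s -> [/\ H q.1.1, H q.1.2 & H q.2]) ->
    \sum_(q <- s) f q.1.1 * g q.1.2 * h q.2 =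
    \sum_i \sum_j \sum_l (\sum_(q <- s) p (al i) q.1.1 * p (al j) q.1.2 * p (al l) q.2)
      * (f (be i) * g (be j) * h (be l)).
  move=> hs; transitivity (\sum_(q <- s) \sum_i \sum_j \sum_l
      p (al i) q.1.1 * p (al j) q.1.2 * p (al l) q.2 * (f (be i) * g (be j) * h (be l))).
    apply: eq_big_seq => q /hs [h1 h2 h3] /=.
    rewrite (lin_on_pairing hf h1) (lin_on_pairing hg h2) (lin_on_pairing hh h3).
    rewrite big_distrlr mulr_suml /=; apply: eq_bigr => i _.
    rewrite mulr_suml; apply: eq_bigr => j _; rewrite mulr_sumr; apply: eq_bigr => l _.
    by rewrite (mulrACA (p (al i) _)) [LHS]mulrACA.
  rewrite exchange_big; apply: eq_bigr => i _; rewrite exchange_big.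
  apply: eq_bigr => j _; rewrite exchange_big; apply: eq_bigr => l _.
  by rewrite mulr_suml.
rewrite !expn //.
by apply: eq_bigr => i _; apply: eq_bigr => j _; apply: eq_bigr => l _; rewrite e.
Qed.

Variables (D : T -> seq (T * T)) (eps : T -> k) (S : T -> T).
Hypothesis hD : forall h, H h -> forall q, q \in D h -> H q.1 /\ H q.2.
Hypothesis Dp : forall h, H h -> forall a a', K a -> K a' ->
  \sum_(q <- D h) p a q.1 * p a' q.2 = p (a * a') h.
Hypothesis epsE : forall h, H h -> eps h = p 1 h.
Hypothesis hS : forall h, H h -> H (S h).
Hypothesis SL : forall c h h', H h -> H h' -> S (c *: h + h') = c *: S h + S h'.
Hypothesis Dmul : forall x y, H x -> H y -> forall a a', K a -> K a' ->
  \sum_(P <- D x) \sum_(Q <- D y) p a (P.1 * Q.1) * p a' (P.2 * Q.2) = p (a * a') (x * y).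
Hypothesis p11 : p 1 1 = 1.
Hypothesis pM1 : forall a a', K a -> K a' -> p (a * a') 1 = p a 1 * p a' 1.
Hypothesis p1M : forall h h', H h -> H h' -> p 1 (h * h') = p 1 h * p 1 h'.
Hypothesis Sl : forall h, H h -> \sum_(q <- D h) S q.1 * q.2 = (eps h)%:A.
Hypothesis Sr : forall h, H h -> \sum_(q <- D h) q.1 * S q.2 = (eps h)%:A.

(** Paired with [K], coassociativity and the counit laws become associativity and the unit laws of
    [K], while [Dmul], [pM1] and [p1M] supply the bialgebra compatibilities. *)
Lemma hopf_of_pairing : is_hopf H D eps S.
Proof.
have K1 := subalg1 hK; have H1 := subalg1 hH.
do ![split=> //].
- move=> c x y hx hy; have hxy := subalgL hH c hx hy.
  apply: teq2_pairing => [q /(hD hxy)//|q|a a' ha ha'].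
    rewrite mem_cat => /orP[/mapP [q' /(hD hx) [h1 h2] ->] /=|/(hD hy)//].
    by split=> //; apply: subalgZ.
  rewrite big_cat big_map /= !Dp ?pLr //; try exact: subalgM.
  rewrite -Dp // mulr_sumr; congr (_ + _); apply: eq_big_seq => q /(hD hx) [h1 h2].
  by rewrite (lin_onZ hH (lin_p ha)) // mulrA.
- by move=> c x y hx hy; rewrite !epsE ?pLr //; apply: subalgL.
- move=> h hh; apply: teq3_pairing.
  + move=> q /flattenP [s /mapP [q' /(hD hh) [h1 h2] ->] /mapP [r /(hD h1) [h3 h4] ->]].
    by [].
  + move=> q /flattenP [s /mapP [q' /(hD hh) [h1 h2] ->] /mapP [r /(hD h2) [h3 h4] ->]].
    by [].
  move=> a a' a'' ha ha' ha''; rewrite !big_flatten !big_map /=.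
  transitivity (p (a * a' * a'') h).
    rewrite -Dp //; last exact: subalgM.
    apply: eq_big_seq => q /(hD hh) [h1 h2]; rewrite big_map /= -mulr_suml; by rewrite Dp.
  rewrite -mulrA -Dp //; last exact: subalgM.
  apply: eq_big_seq => q /(hD hh) [h1 h2]; rewrite big_map /=.
  by rewrite -Dp // mulr_sumr; apply: eq_bigr => r _; rewrite mulrA.
- move: H0 => hh; apply: pairing_ext => //.
    rewrite big_seq; elim/big_ind: _ => [|u v|q /(hD hh) [h1 h2]]; first exact: subalg0.
    + exact: subalgD.
    + exact: subalgZ.
  move=> a ha; rewrite (lin_on_lincomb hH (lin_p ha)) => [|q /(hD hh) []//].
  rewrite -[in RHS](mul1r a) -Dp //; apply: eq_big_seq => q /(hD hh) [h1 h2].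
  by rewrite epsE.
- move: H0 => hh; apply: pairing_ext => //.
    rewrite big_seq; elim/big_ind: _ => [|u v|q /(hD hh) [h1 h2]]; first exact: subalg0.
    + exact: subalgD.
    + exact: subalgZ.
  move=> a ha; rewrite (lin_on_lincomb hH (lin_p ha)) => [|q /(hD hh) []//].
  rewrite -[in RHS](mulr1 a) -Dp //; apply: eq_big_seq => q /(hD hh) [h1 h2].
  by rewrite epsE // mulrC.
- apply: teq2_pairing => [q /(hD H1)//|q|a a' ha ha'].
    by rewrite inE => /eqP ->.
  by rewrite Dp // big_seq1 pM1.
- move=> x y hx hy; have hxy := subalgM hH hx hy.
  apply: teq2_pairing => [q /(hD hxy)//|q|a a' ha ha'].
    move=> /allpairsP [[P Q] [/(hD hx) [h1 h2] /(hD hy) [h3 h4] ->]] /=.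
    by split; apply: subalgM.
  by rewrite Dp // -Dmul // big_allpairs_dep.
- by rewrite epsE.
- by move=> x y hx hy; rewrite !epsE ?p1M //; apply: subalgM.
- exact: Sl.
- exact: Sr.
Qed.

End HopfOfPairing.

(** * The Hopf structure on the dual side *)

Section DualHopf.
Variables (k : fieldType) (T : algType k) (K H : T -> Prop) (p : T -> T -> k).
Variables (d : nat) (al be : 'I_d -> T).
Hypotheses (hK : is_subalg K) (hH : is_subalg H).
Hypotheses (hal : forall i, K (al i)) (hbe : forall i, H (be i)).
Hypothesis pLl : forall c a a' h, K a -> K a' -> H h ->
  p (c *: a + a') h = c * p a h + p a' h.
Hypothesis pLr : forall c a h h', K a -> H h -> H h' ->
  p a (c *: h + h') = c * p a h + p a h'.
Hypothesis expand : forall h, H h -> \sum_i p (al i) h *: be i = h.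
Hypothesis expandK : forall a, K a -> \sum_i p a (be i) *: al i = a.

Variables (D : T -> seq (T * T)) (eps : T -> k) (S : T -> T).
Hypothesis hD : forall h, H h -> forall q, q \in D h -> H q.1 /\ H q.2.
Hypothesis Dp : forall h, H h -> forall a a', K a -> K a' ->
  \sum_(q <- D h) p a q.1 * p a' q.2 = p (a * a') h.
Hypothesis epsE : forall h, H h -> eps h = p 1 h.
Hypothesis hS : forall h, H h -> H (S h).
Hypothesis SL : forall c h h', H h -> H h' -> S (c *: h + h') = c *: S h + S h'.
Hypothesis Dmul : forall x y, H x -> H y -> forall a a', K a -> K a' ->
  \sum_(P <- D x) \sum_(Q <- D y) p a (P.1 * Q.1) * p a' (P.2 * Q.2) = p (a * a') (x * y).
Hypothesis p11 : p 1 1 = 1.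
Hypothesis pM1 : forall a a', K a -> K a' -> p (a * a') 1 = p a 1 * p a' 1.
Hypothesis p1M : forall h h', H h -> H h' -> p 1 (h * h') = p 1 h * p 1 h'.
Hypothesis Sl : forall h, H h -> \sum_(q <- D h) S q.1 * q.2 = (eps h)%:A.
Hypothesis Sr : forall h, H h -> \sum_(q <- D h) q.1 * S q.2 = (eps h)%:A.

(** The transpose of the product of [H] in the dual bases [al] and [be]; the coefficient sits in the
    second leg because lists of simple tensors carry none. *)
Definition dual_comul a : seq (T * T) :=
  [seq (al ij.1, p a (be ij.1 * be ij.2) *: al ij.2) | ij <- enum {: 'I_d * 'I_d}].

Definition dual_antipode a : T := \sum_i p a (S (be i)) *: al i.

Let lin_pl h : H h -> lin_on K (fun a => p a h).
Proof. by move=> hh c a a' ha ha'; apply: pLl. Qed.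

Let lin_pr a : K a -> lin_on H (p a).
Proof. by move=> ha c h h' hh hh'; apply: pLr. Qed.

Let S_sum (I : Type) (s : seq I) (c : I -> k) (F : I -> T) : (forall i, H (F i)) ->
  S (\sum_(i <- s) c i *: F i) = \sum_(i <- s) c i *: S (F i).
Proof.
move=> hF; elim: s => [|i s IH].
  rewrite !big_nil; have h0 := subalg0 hH.
  by rewrite -[X in S X](addNr 0) -scaleN1r SL // scaleN1r addNr.
rewrite !big_cons SL ?IH //; apply: subalg_sum => // j; exact: subalgZ.
Qed.

Lemma dual_comul_in a : forall q, q \in dual_comul a -> K q.1 /\ K q.2.
Proof. by move=> q /mapP [ij _ ->]; split=> //=; apply: (subalgZ hK). Qed.

Lemma dual_comulP a : K a -> forall h h', H h -> H h' ->
  \sum_(q <- dual_comul a) p q.1 h * p q.2 h' = p a (h * h').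
Proof.
move=> ha h h' hh hh'; rewrite big_map big_enum /=.
transitivity (\sum_i \sum_j (p (al i) h * p (al j) h') * p a (be i * be j)).
  rewrite pair_big /=; apply: eq_bigr => ij _.
  by rewrite (lin_onZ hK (lin_pl hh')) // mulrCA mulrC.
have -> : h * h' = \sum_i p (al i) h *: (be i * h').
  by rewrite -{1}(expand hh) mulr_suml; apply: eq_bigr => i _; rewrite -scalerAl.
rewrite (lin_on_lincomb hH (lin_pr ha)) => [|i _]; last exact: subalgM.
apply: eq_bigr => i _.
have -> : be i * h' = \sum_j p (al j) h' *: (be i * be j).
  by rewrite -{1}(expand hh') mulr_sumr; apply: eq_bigr => j _; rewrite -scalerAr.
rewrite (lin_on_lincomb hH (lin_pr ha)) => [|j _]; last exact: subalgM.
by rewrite mulr_sumr; apply: eq_bigr => j _; rewrite mulrA.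
Qed.

Lemma dual_antipode_in a : K (dual_antipode a).
Proof. by apply: subalg_sum => // i; apply: subalgZ. Qed.

Lemma dual_antipodeP a h : K a -> H h -> p (dual_antipode a) h = p a (S h).
Proof.
move=> ha hh; rewrite (lin_on_lincomb hK (lin_pl hh)) //.
rewrite -{2}(expand hh) S_sum // (lin_on_lincomb hH (lin_pr ha)) => [|i _]; last exact: hS.
by apply: eq_bigr => i _; rewrite mulrC.
Qed.

(** [hopf_of_pairing] is applied with the two sides exchanged, each axiom for [K] being the
    transpose of one for [H]. *)
Lemma dual_hopf : is_hopf K dual_comul (fun a => p a 1) dual_antipode.
Proof.
have K1 := subalg1 hK; have H1 := subalg1 hH; have hSA := dual_antipode_in.
(* Both antipode laws follow this pattern: [G] is the transpose of [F], and elements of [K] with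
   equal pairings are equal by [expandK]. *)
have antipode_ext a (F : T * T -> T) (G : T * T -> T) : K a ->
    (forall q, K q.1 -> K q.2 -> K (F q)) ->
    (forall q, H q.1 -> H q.2 -> H (G q)) ->
    (forall h, H h -> \sum_(P <- D h) G P = (eps h)%:A) ->
    (forall h, H h -> \sum_(r <- dual_comul a) p (F r) h = \sum_(P <- D h) p a (G P)) ->
    \sum_(q <- dual_comul a) F q = (p a 1)%:A.
  move=> ha hF hG sG FG.
  have inF q : q \in dual_comul a -> K (F q) by move=> /dual_comul_in [q1 q2]; apply: hF.
  have K_lhs : K (\sum_(q <- dual_comul a) F q).
    by rewrite big_map; apply: subalg_sum => // ij; apply: hF => //=; apply: (subalgZ hK).
  have e h : H h -> p (\sum_(q <- dual_comul a) F q) h = p (p a 1)%:A h.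
    move=> hh; rewrite (lin_on_sum hK (lin_pl hh)) // FG //.
    rewrite (lin_onZ hK (lin_pl hh)) // -epsE // mulrC.
    rewrite -(lin_onZ hH (lin_pr ha)) // -sG // (lin_on_sum hH (lin_pr ha)) // => P.
    by move=> /(hD hh) [P1 P2]; apply: hG.
  rewrite -(expandK K_lhs) -[RHS](expandK (subalgA hK _)).
  by apply: eq_bigr => i _; rewrite e.
apply: (@hopf_of_pairing _ _ H K (fun h a => p a h) d be al) => //.
- by move=> c a h h' ha hh hh'; apply: pLl.
- by move=> a ha q; apply: dual_comul_in.
- by move=> a ha h h' hh hh'; apply: dual_comulP.
- move=> c a a' ha ha'; rewrite scaler_sumr -big_split; apply: eq_bigr => i _ /=.
  by rewrite pLl ?scalerDl ?scalerA //; apply: hS.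
(* The compatibility of product and coproduct is self-dual: both sides unfold to the same sum over
   four coproducts. *)
- move=> a a' ha ha' h h' hh hh'.
  rewrite -Dmul //.
  transitivity (\sum_(r <- dual_comul a) \sum_(t <- dual_comul a')
      \sum_(P <- D h) \sum_(Q <- D h')
        (p r.1 P.1 * p r.2 Q.1) * (p t.1 P.2 * p t.2 Q.2)).
    apply: eq_big_seq => r /dual_comul_in [r1 r2].
    apply: eq_big_seq => t /dual_comul_in [t1 t2].
    rewrite -!Dp // big_distrlr /=; apply: eq_bigr => P _; apply: eq_bigr => Q _.
    by rewrite mulrACA.
  under eq_bigr => r _ do rewrite exchange_big.
  rewrite exchange_big; apply: eq_big_seq => P /(hD hh) [P1 P2] /=.
  under eq_bigr => r _ do rewrite exchange_big.
  rewrite exchange_big; apply: eq_big_seq => Q /(hD hh') [Q1 Q2] /=.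
  rewrite -dual_comulP // -(dual_comulP ha') // big_distrlr /=.
  by [].
- move=> a ha; apply: (antipode_ext a _ (fun P => S P.1 * P.2)) => //.
  + by move=> q q1 q2; apply: subalgM.
  + by move=> q q1 q2; apply: subalgM => //; apply: hS.
  move=> h hh.
  transitivity (\sum_(r <- dual_comul a) \sum_(P <- D h) p r.1 (S P.1) * p r.2 P.2).
    apply: eq_big_seq => r /dual_comul_in [r1 r2]; rewrite -Dp //.
    by apply: eq_big_seq => P /(hD hh) [P1 P2]; rewrite dual_antipodeP.
  rewrite exchange_big; apply: eq_big_seq => P /(hD hh) [P1 P2] /=.
  by rewrite dual_comulP //; apply: hS.
- move=> a ha; apply: (antipode_ext a _ (fun P => P.1 * S P.2)) => //.
  + by move=> q q1 q2; apply: subalgM.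
  + by move=> q q1 q2; apply: subalgM => //; apply: hS.
  move=> h hh.
  transitivity (\sum_(r <- dual_comul a) \sum_(P <- D h) p r.1 P.1 * p r.2 (S P.2)).
    apply: eq_big_seq => r /dual_comul_in [r1 r2]; rewrite -Dp //.
    by apply: eq_big_seq => P /(hD hh) [P1 P2]; rewrite dual_antipodeP.
  rewrite exchange_big; apply: eq_big_seq => P /(hD hh) [P1 P2] /=.
  by rewrite dual_comulP //; apply: hS.
Qed.

End DualHopf.

(** * The tower [N], [M], [M1], [T], with the whole of [T] as the top algebra *)

Section Tower.
Variables (k : fieldType) (T : algType k) (N M M1 : T -> Prop) (E EM EM1 : T -> T).
Variables (n : nat) (x y : 'I_n -> T) (lam : k) (e1 e2 : T).
Hypotheses (fr0 : frobenius N M E lam x y) (hlam : lam != 0).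
Hypotheses (hM1 : is_subalg M1) (hMM1 : forall z, M z -> M1 z).
Hypothesis hirr : forall m, centralizer M N m -> is_scalar m.
Hypothesis hbc1 : basic_construction N M M1 E lam e1 EM.
Hypothesis hbc2 : basic_construction M M1 (fun _ => True) EM lam e2 EM1.

Let A := centralizer M1 N.
Let B := centralizer (fun _ : T => True) M.

Let hM := frob_R fr0.
Let hNM := frob_SR fr0.
Let fr1 := bc_frobenius fr0 hlam hM1 hMM1 hbc1.
Let full : is_subalg (fun _ : T => True) := subalg_full T.
Let fr2 := bc_frobenius fr1 hlam full (fun _ _ => I) hbc2.
Let irr1 := bc_irreducible fr0 hlam hM1 hMM1 hbc1 hirr.
Let hA : is_subalg A := centralizer_subalg N hM1.
Let hB : is_subalg B := centralizer_subalg M full.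
Let M1_1 := subalg1 hM1.
Let M_1 := subalg1 hM.
Let M1_e1 := bc_e hbc1.

Lemma A_M1 a : A a -> M1 a. Proof. by case. Qed.

Lemma A_e1 : A e1.
Proof. by split=> // s hs; apply: (bc_comm hbc1). Qed.

Let EM1_in z : M1 (EM1 z) := frob_E fr2 I.

(** * The right and left actions of [B] on [M1] *)

Definition ract z b := lam^-1 *: EM1 (e2 * z * b).
Definition lact b z := lam^-1 *: EM1 (b * z * e2).

Lemma ract_in z b : M1 (ract z b).
Proof. exact: subalgZ. Qed.

Lemma lact_in z b : M1 (lact b z).
Proof. exact: subalgZ. Qed.

Let hract := ract_in.
Let hlact := lact_in.

Lemma ract_bimod b m z m' : B b -> M m -> M m' -> ract (m * z * m') b = m * ract z b * m'.
Proof.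
move=> [_ cb] hm hm'; rewrite /ract -scalerAr -scalerAl -(frob_bimod fr2) //; auto.
by rewrite !mulrA (bc_comm hbc2) // -(mulrA _ m' b) -cb // !mulrA.
Qed.

Lemma lact_bimod b m z m' : B b -> M m -> M m' -> lact b (m * z * m') = m * lact b z * m'.
Proof.
move=> [_ cb] hm hm'; rewrite /lact -scalerAr -scalerAl -(frob_bimod fr2) //; auto.
by rewrite !mulrA cb // -(mulrA _ m' e2) -(bc_comm hbc2) // !mulrA.
Qed.

Lemma ractMl b m z : B b -> M m -> ract (m * z) b = m * ract z b.
Proof. by move=> hb hm; rewrite -[m * z]mulr1 ract_bimod // mulr1. Qed.

Lemma ractMr b m z : B b -> M m -> ract (z * m) b = ract z b * m.
Proof. by move=> hb hm; rewrite -[z * m]mul1r mulrA ract_bimod // mul1r. Qed.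

Lemma ractD z z' b : ract (z + z') b = ract z b + ract z' b.
Proof. by rewrite /ract mulrDr mulrDl (frob_add fr2) // scalerDr. Qed.

Lemma lactMl b m z : B b -> M m -> lact b (m * z) = m * lact b z.
Proof. by move=> hb hm; rewrite -[m * z]mulr1 lact_bimod // mulr1. Qed.

Lemma lactMr b m z : B b -> M m -> lact b (z * m) = lact b z * m.
Proof. by move=> hb hm; rewrite -[z * m]mul1r mulrA lact_bimod // mul1r. Qed.

Lemma lactD z z' b : lact b (z + z') = lact b z + lact b z'.
Proof. by rewrite /lact mulrDr mulrDl (frob_add fr2) // scalerDr. Qed.

Lemma ractLr c z b b' : ract z (c *: b + b') = c *: ract z b + ract z b'.
Proof.
by rewrite /ract mulrDr -scalerAr (frobL fr2) // scalerDr !scalerA (mulrC c).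
Qed.

Lemma lactL c z b b' : lact (c *: b + b') z = c *: lact b z + lact b' z.
Proof.
rewrite /lact !mulrDl -!scalerAl (frobL fr2) //.
by rewrite scalerDr !scalerA (mulrC c).
Qed.

Lemma ract0 z : ract z 0 = 0.
Proof. by rewrite -[X in ract z X](addNr 0) -scaleN1r ractLr scaleN1r addNr. Qed.

Lemma ractZ c z b : ract z (c *: b) = c *: ract z b.
Proof. by rewrite -[c *: b]addr0 ractLr ract0 addr0. Qed.

Lemma ract_sumr I (s : seq I) z (F : I -> T) :
  ract z (\sum_(i <- s) F i) = \sum_(i <- s) ract z (F i).
Proof. by rewrite /ract mulr_sumr (frob_sum fr2) // scaler_sumr. Qed.

Lemma ract_suml I (s : seq I) b (F : I -> T) :
  ract (\sum_(i <- s) F i) b = \sum_(i <- s) ract (F i) b.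
Proof. by rewrite /ract mulr_sumr mulr_suml (frob_sum fr2) // scaler_sumr. Qed.

Lemma ract1 z : M1 z -> ract z 1 = z.
Proof.
move=> hz; rewrite /ract mulr1 -[e2]mul1r (bc_E1 hbc2) // mul1r scalerA.
by rewrite mulVf // scale1r.
Qed.

Lemma lact1 z : M1 z -> lact 1 z = z.
Proof.
move=> hz; rewrite /lact mul1r -[z * e2]mulr1 (bc_E1 hbc2) // mulr1 scalerA.
by rewrite mulVf // scale1r.
Qed.

Lemma ractM z b b' : ract (ract z b) b' = ract z (b * b').
Proof.
rewrite /ract -scalerAr -(mulrA e2 z b) (bc_eE1 fr1 full (fun _ _ => I) hbc2) //.
by rewrite scalerA mulVf // scale1r !mulrA.
Qed.

Lemma lactM z b b' : lact b (lact b' z) = lact (b * b') z.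
Proof.
rewrite /lact -scalerAr -scalerAl -(mulrA b (EM1 _)) (bc_E1e fr1 full (fun _ _ => I) hbc2) //.
by rewrite -scalerAr scalerA mulVf // scale1r !mulrA.
Qed.

Lemma ract_A a b : A a -> B b -> A (ract a b).
Proof.
move=> [ha ca] hb; split=> // s hs; have hs' := hNM hs.
by rewrite -ractMr // -ractMl // ca.
Qed.

Lemma lact_A a b : A a -> B b -> A (lact b a).
Proof.
move=> [ha ca] hb; split=> // s hs; have hs' := hNM hs.
by rewrite -lactMr // -lactMl // ca.
Qed.

(** The second dual basis of [M1] in [T] consists of the [e2 * (e1 * y i)], so non-degeneracy of
    [EM1] applies once the difference acts by zero on the [e1 * y i]. *)
Lemma ract_inj b b' : (forall z, M1 z -> ract z b = ract z b') -> b = b'.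
Proof.
move=> h; apply/eqP; rewrite -subr_eq0; apply/eqP.
apply: (frob_nondegr fr2) => // i; have hy := frob_y fr1 i.
have : ract (e1 * y i) (-1 *: b' + b) = 0 by rewrite ractLr h // scaleN1r addNr.
move/(congr1 (fun t => lam *: t)); rewrite scaler0 scalerA divff // scale1r.
by rewrite scaleN1r addrC.
Qed.

Lemma ract_e1_inj b b' : B b -> B b' -> ract e1 b = ract e1 b' -> b = b'.
Proof.
move=> hb hb' e; apply: ract_inj.
apply: (bc_bimod_ext fr0 hM1 hMM1 hbc1 (f := ract^~ b) (g := ract^~ b')) => //.
- by move=> a c ha hc; apply: ract_bimod.
- by move=> a c ha hc; apply: ract_bimod.
- by move=> z z' _ _; apply: ractD.
- by move=> z z' _ _; apply: ractD.
Qed.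

(** The Casimir tensor of [x] and [y] over [N] commutes with [M]; a [z] commuting with [N] may be
    inserted in its middle. *)
Lemma casimir_centralizer z : (forall s, N s -> z * s = s * z) -> B (\sum_i x i * z * y i).
Proof.
have hx := frob_x fr0; have hy := frob_y fr0.
move=> cz; split=> // m hm; symmetry; rewrite mulr_sumr mulr_suml.
transitivity (\sum_i \sum_j x j * z * (E (y j * (m * x i)) * y i)).
  apply: eq_bigr => i _; rewrite mulrA mulrA -{1}(frob_r fr0 (subalgM hM hm (hx i))).
  rewrite !mulr_suml; apply: eq_bigr => j _.
  have hE : N (E (y j * (m * x i))) by apply: (frob_E fr0); do !apply: subalgM.
  by rewrite -(mulrA (x j)) -cz // !mulrA.
rewrite exchange_big; apply: eq_bigr => j _ /=; rewrite -mulr_sumr.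
under eq_bigr => i _ do rewrite mulrA.
by rewrite (frob_l fr0) ?mulrA //; apply: subalgM.
Qed.

Let E_comm i a : A a -> a * E (x i) = E (x i) * a.
Proof. by move=> [_ ca]; apply: ca; apply/(frob_E fr0)/(frob_x fr0). Qed.

Let e2_N s : N s -> e2 * s = s * e2.
Proof. by move=> hs; apply: (bc_comm hbc2); apply: hNM. Qed.

Let e2e1e2 : e2 * e1 * e2 = lam *: e2.
Proof.
rewrite (bc_ere hbc2) // -[e1]mul1r -[1 * e1]mulr1 (bc_E1 hbc1) // mulr1.
by rewrite -scalerAl mul1r.
Qed.

(** Solutions in [B] of [ract e1 b = a] and [lact b e1 = a]: the middle factor commutes with [N],
    the Casimir sum brings it into [B], and [lam^-1] compensates the factor in [e2e1e2]. *)
Definition ract_inv a := lam^-1 *: \sum_i x i * (e1 * e2 * a) * y i.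
Definition lact_inv a := lam^-1 *: \sum_i x i * (a * e2 * e1) * y i.

Lemma ract_inv_in a : A a -> B (ract_inv a).
Proof.
move=> [_ ca]; apply: subalgZ => //; apply: casimir_centralizer => s hs.
by rewrite -!mulrA ca // (mulrA e2) e2_N // -!mulrA (mulrA e1) (bc_comm hbc1) // !mulrA.
Qed.

Lemma lact_inv_in a : A a -> B (lact_inv a).
Proof.
move=> [_ ca]; apply: subalgZ => //; apply: casimir_centralizer => s hs.
by rewrite -!mulrA (bc_comm hbc1) // (mulrA e2) e2_N // -!mulrA (mulrA a) ca // !mulrA.
Qed.

Lemma ract_invK a : A a -> ract e1 (ract_inv a) = a.
Proof.
move=> ha; rewrite /ract_inv ractZ ract_sumr.
have hx := frob_x fr0; have hy := frob_y fr0.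
have hE i : N (E (x i)) by apply: (frob_E fr0).
transitivity (lam^-1 *: \sum_i lam *: (a * (E (x i) * y i))).
  congr (_ *: _); apply: eq_bigr => i _; rewrite /ract.
  (* [e1 * x i * e1] collapses to [E (x i) * e1], whose coefficient passes through [e2], and then
     [e2 * e1 * e2] is [lam *: e2]. The sum of the [E (x i) * y i] left at the end is 1. *)
  have -> : e2 * e1 * (x i * (e1 * e2 * a) * y i) = lam *: (1 * e2 * (a * E (x i) * y i)).
    rewrite mul1r -!mulrA (mulrA e1 (x i)) (mulrA _ e1) (bc_ere hbc1) // -!mulrA.
    rewrite (mulrA e2) e2_N // -mulrA (mulrA e2 e1) (mulrA (e2 * e1)) e2e1e2.
    by rewrite -scalerAl -scalerAr (mulrA a) E_comm // !mulrA e2_N.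
  rewrite (frobZ fr2) // (bc_E1 hbc2) //; last first.
    by apply: subalgM; auto; apply: subalgM; auto; case: ha.
  by rewrite mul1r scalerA mulVf // scale1r mulrA.
rewrite -scaler_sumr scalerA mulVf // scale1r -mulr_sumr.
have := frob_l fr0 M_1; under eq_bigr => i _ do rewrite mul1r.
by move=> ->; rewrite mulr1.
Qed.

Lemma lact_invK a : A a -> lact (lact_inv a) e1 = a.
Proof.
move=> ha; have hx := frob_x fr0; have hy := frob_y fr0.
have hE i : N (E (y i)) by apply: (frob_E fr0).
have lactZ c b z : lact (c *: b) z = c *: lact b z.
  by rewrite /lact -!scalerAl (frobZ fr2) // !scalerA mulrC.
rewrite /lact_inv lactZ.
have -> : lact (\sum_i x i * (a * e2 * e1) * y i) e1 = \sum_i lact (x i * (a * e2 * e1) * y i) e1.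
  by rewrite /lact !mulr_suml (frob_sum fr2) // scaler_sumr.
transitivity (lam^-1 *: \sum_i lam *: (x i * E (y i) * a)).
  congr (_ *: _); apply: eq_bigr => i _; rewrite /lact.
  have -> : x i * (a * e2 * e1) * y i * e1 * e2 = lam *: (x i * E (y i) * a * e2 * 1).
    rewrite mulr1 -!mulrA (mulrA e1 (y i)) (mulrA (e1 * y i)) (bc_ere hbc1) // -!mulrA.
    rewrite (mulrA e2) e2_N // -mulrA (mulrA e2 e1) e2e1e2.
    rewrite -!scalerAr (mulrA a (E _)); congr (_ *: (_ * _)).
    by case: ha => _ ca; rewrite ca // !mulrA.
  rewrite (frobZ fr2) // (bc_E1 hbc2) //; last first.
    by apply: subalgM; auto; [apply: subalgM; auto | case: ha].
  by rewrite mulr1 scalerA mulVf // scale1r.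
rewrite -scaler_sumr scalerA mulVf // scale1r -mulr_suml.
have := frob_r fr0 M_1; under eq_bigr => i _ do rewrite mulr1.
by move=> ->; rewrite mul1r.
Qed.

(** * The antipode of [B] *)

Definition antip b := ract_inv (lact b e1).
Definition antip_inv b := lact_inv (ract e1 b).

Lemma antip_in b : B b -> B (antip b).
Proof. by move=> hb; apply/ract_inv_in/lact_A => //; apply: A_e1. Qed.

Lemma antip_inv_in b : B b -> B (antip_inv b).
Proof. by move=> hb; apply/lact_inv_in/ract_A => //; apply: A_e1. Qed.

Lemma ract_antip_e1 b : B b -> ract e1 (antip b) = lact b e1.
Proof. by move=> hb; apply/ract_invK/lact_A => //; apply: A_e1. Qed.

Lemma ract_antip b z : B b -> M1 z -> ract z (antip b) = lact b z.
Proof.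
move=> hb; have hSb := antip_in hb.
apply: (bc_bimod_ext fr0 hM1 hMM1 hbc1 (f := ract^~ (antip b)) (g := lact b)) => //.
- by move=> a c ha hc; apply: ract_bimod.
- by move=> a c ha hc; apply: lact_bimod.
- by move=> z1 z' _ _; apply: ractD.
- by move=> z1 z' _ _; apply: lactD.
- exact: ract_antip_e1.
Qed.

(** Surjectivity of the antipode, which allows structures to be transported along it. *)
Lemma antip_invK b : B b -> antip (antip_inv b) = b.
Proof.
move=> hb; have hs := antip_inv_in hb; apply: ract_e1_inj => //; first exact: antip_in.
by rewrite ract_antip_e1 // lact_invK //; apply: ract_A => //; apply: A_e1.
Qed.

(** [ract] is a right action and [lact] a left one, so passing from one to the other reverses
    products. *)
Lemma antipM b b' : B b -> B b' -> antip (b * b') = antip b' * antip b.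
Proof.
move=> hb hb'; have hbb := subalgM hB hb hb'.
have hSb := antip_in hb; have hSb' := antip_in hb'.
apply: ract_e1_inj; [exact: antip_in|exact: subalgM|].
by rewrite -ractM !ract_antip // lactM.
Qed.

Lemma antip1 : antip 1 = 1.
Proof.
have B1 := subalg1 hB; apply: ract_e1_inj => //; first exact: antip_in.
by rewrite ract_antip_e1 // lact1 // ract1.
Qed.

Lemma antipL c b b' : B b -> B b' -> antip (c *: b + b') = c *: antip b + antip b'.
Proof.
move=> hb hb'; have hbb := subalgL hB c hb hb'.
have hSb := antip_in hb; have hSb' := antip_in hb'.
apply: ract_e1_inj; [exact: antip_in|exact: subalgL|].
by rewrite ractLr !ract_antip_e1 // lactL.
Qed.

Lemma antip0 : antip 0 = 0.
Proof.
have B0 := subalg0 hB.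
by rewrite -[X in antip X](addNr 0) -scaleN1r antipL // scaleN1r addNr.
Qed.

Lemma antipZ c b : B b -> antip (c *: b) = c *: antip b.
Proof.
by move=> hb; rewrite -[c *: b]addr0 antipL ?antip0 ?addr0 //; apply: subalg0.
Qed.

Lemma antip_sum (I : Type) (s : seq I) (F : I -> T) : (forall i, B (F i)) ->
  antip (\sum_(i <- s) F i) = \sum_(i <- s) antip (F i).
Proof.
move=> hF; elim: s => [|i s IH]; first by rewrite !big_nil antip0.
by rewrite !big_cons -[F i]scale1r antipL ?IH ?scale1r //; apply: subalg_sum.
Qed.

Lemma EM_adjoint b z z' : M1 z -> M1 z' -> EM (z * lact b z') = EM (ract z b * z').
Proof.
move=> hz hz'; rewrite /lact /ract -scalerAr -scalerAl -(frobMl fr2) // -(frobMr fr2) //.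
rewrite !(frobZ fr1) //; congr (_ *: _).
by rewrite !mulrA (bc_trace_e fr1 hlam full (fun _ _ => I) hbc2) // !mulrA.
Qed.

Lemma EM_antip b z z' : B b -> M1 z -> M1 z' ->
  EM (ract z b * z') = EM (z * ract z' (antip b)).
Proof. by move=> hb hz hz'; rewrite -EM_adjoint // ract_antip. Qed.

(** [1] commutes with [M], so [ract 1 b] lies in the trivial centralizer of [M] in [M1]. As a
    function of [b] it is the counit of the coproduct given by [comat]. *)
Lemma ract1_scalar b : B b -> is_scalar (ract 1 b).
Proof.
move=> hb; apply: irr1; split=> // m hm.
by rewrite -ractMr // -ractMl // mul1r mulr1.
Qed.

Lemma lact1_scalar b : B b -> is_scalar (lact b 1).
Proof.
move=> hb; apply: irr1; split=> // m hm.
by rewrite -lactMr // -lactMl // mul1r mulr1.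
Qed.

(** [EM_adjoint] with [z' = 1] gives the factor [lact b 1]; evaluating at 1 identifies it with
    [ract 1 b]. *)
Lemma EM_ract b z : B b -> M1 z -> EM (ract z b) = ract 1 b * EM z.
Proof.
move=> hb.
have h z' : M1 z' -> EM (ract z' b) = lact b 1 * EM z'.
  move=> hz'; rewrite -[ract z' b]mulr1 -EM_adjoint //.
  have [c ->] := lact1_scalar hb.
  by rewrite -scalerAr mulr1 (frobZ fr1) // -scalerAl mul1r.
move=> hz; rewrite h //; congr (_ * _).
have := h 1 M1_1; rewrite (frob_E1 fr1) mulr1 => <-.
by have [c ->] := ract1_scalar hb; rewrite (frobZ fr1) // (frob_E1 fr1).
Qed.

Lemma EM_ract_inj b b' : 
  (forall z z', M1 z -> M1 z' -> EM (z' * ract z b) = EM (z' * ract z b')) -> b = b'.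
Proof.
move=> h; apply: ract_inj => z hz; apply/eqP; rewrite -subr_eq0; apply/eqP.
have hd : M1 (ract z b - ract z b') by rewrite addrC -scaleN1r; apply: subalgL.
apply: (frob_nondegr fr1) => // i; have hy := frob_y fr1 i.
rewrite mulrBr addrC -scaleN1r (frobL fr1) ?scaleN1r ?h ?addNr //; exact: subalgM.
Qed.

(** * The counit of [A] and the pairing *)

Lemma e1_scal a : A a -> is_scalar (EM (a * e1)) /\ a * e1 = (lam^-1 *: EM (a * e1)) * e1.
Proof.
move=> ha; split.
  by apply: (frob_centralizer_scalar fr1 hNM hirr); apply: subalgM => //; apply: A_e1.
rewrite -scalerAl (bc_E1e fr0 hM1 hMM1 hbc1) ?scalerA ?mulVf ?scale1r //.
by case: ha.
Qed.

Definition epsA a := lam^-1 *: EM (a * e1).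

Lemma epsA_scalar a : A a -> is_scalar (epsA a).
Proof. by move=> /e1_scal [h _]; apply: is_scalarZ. Qed.

(** By [e1_scal], [a' * e1] is the multiple of [e1] by the scalar [epsA a'], which comes out of
    [EM]. *)
Lemma epsAM a a' : A a -> A a' -> epsA (a * a') = epsA a * epsA a'.
Proof.
move=> ha ha'; rewrite {1}/epsA -mulrA; have [_ ->] := e1_scal ha'.
have hs := epsA_scalar ha'; rewrite -/(epsA a').
have ha1 : M1 (a * e1) by apply: subalgM => //; case: ha.
by rewrite (scalMl _ hs) -scalerAr (frobZ fr1) // (scalMr _ hs) scalerA mulrC -scalerA.
Qed.

(** The pairing of [a] with [antip b], by [pairing_antip]; in this form it inherits the product
    rules of [ract]. *)
Definition qpair a b := epsA (ract a b).

Let pr := pairing lam EM EM1 e1 e2.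

Lemma pairingE a b : M1 a -> pr a b = lam^-1 *: EM (a * ract e1 b).
Proof.
move=> ha; rewrite /pr /pairing /ract -scalerAr -!(mulrA a) (frobMl fr2) // ?mulrA.
rewrite (frobZ fr1); last exact: subalgM.
by rewrite scalerA -expr2 exprVn.
Qed.

Lemma pairing_antip a b : A a -> B b -> pr a (antip b) = qpair a b.
Proof. by move=> [ha _] hb; rewrite pairingE // -EM_antip. Qed.

Lemma pairing_scalar a b : A a -> B b -> is_scalar (pr a b).
Proof.
move=> ha hb; rewrite pairingE; last by case: ha.
apply: is_scalarZ; apply: (frob_centralizer_scalar fr1 hNM hirr).
by apply: subalgM => //; apply: ract_A => //; apply: A_e1.
Qed.

(** * The comultiplication of [B] in matrix coefficients *)

Variables (d : nat) (u v : 'I_d -> T).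
Hypothesis cb : centralizer_basis B (fun _ => True) EM1 lam u v.

Let hu := cb_u cb.
Let hv := cb_v cb.

(** The coefficient [EM1 (v j * z * b)] of [z * b] on [u j] is an [M]-bimodule map in [z], hence the
    action of one element of [B], found from its value at [e1]. The tensor with legs [u j] and
    [comat j b] is the coproduct for which [M1] is a module algebra. *)
Definition comat j b := ract_inv (EM1 (v j * e1 * b)).

Let EM1_v_bimod j b m z m' : B b -> M m -> M m' ->
  EM1 (v j * (m * z * m') * b) = m * EM1 (v j * z * b) * m'.
Proof.
move=> [_ cb'] hm hm'; rewrite -(frob_bimod fr2) //; auto.
by case: (hv j) => _ cv; rewrite !mulrA cv // -(mulrA _ m' b) -cb' // !mulrA.
Qed.

Let EM1_v_A j b : B b -> A (EM1 (v j * e1 * b)).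
Proof.
move=> hb; split=> // s hs; have hs' := hNM hs.
rewrite -[LHS]mul1r mulrA -EM1_v_bimod // mul1r (bc_comm hbc1) //.
by rewrite -[s * e1]mulr1 EM1_v_bimod // mulr1.
Qed.

Lemma comat_in j b : B b -> B (comat j b).
Proof. by move=> hb; apply/ract_inv_in/EM1_v_A. Qed.

Lemma ract_comat j z b : B b -> M1 z -> ract z (comat j b) = EM1 (v j * z * b).
Proof.
move=> hb; have hw := comat_in j hb.
apply: (bc_bimod_ext fr0 hM1 hMM1 hbc1 (f := ract^~ (comat j b))
          (g := fun z => EM1 (v j * z * b))) => //.
- by move=> a c ha hc; apply: ract_bimod.
- by move=> a c ha hc; apply: EM1_v_bimod.
- by move=> z1 z' _ _; apply: ractD.
- by move=> z1 z' _ _; rewrite mulrDr mulrDl (frob_add fr2).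
- by apply/ract_invK/EM1_v_A.
Qed.

Lemma mul_comat z b : B b -> M1 z -> z * b = \sum_j u j * ract z (comat j b).
Proof.
move=> hb hz; rewrite -[LHS](cb_l cb) //; apply: eq_bigr => j _.
by rewrite ract_comat // mulrA.
Qed.

Lemma ract_mul z z' b : B b -> M1 z -> M1 z' ->
  ract (z * z') b = \sum_j ract z (u j) * ract z' (comat j b).
Proof.
move=> hb hz hz'; rewrite {1}/ract -!mulrA (mul_comat hb hz') !mulr_sumr (frob_sum fr2) //.
rewrite scaler_sumr; apply: eq_bigr => j _.
by rewrite [ract z (u j)]/ract -scalerAl -(frobMr fr2) // !mulrA.
Qed.

(** The [comat i (u j)] comultiply like matrix coefficients, which makes the matrix of their
    antipodes a candidate inverse. *)
Lemma ract_mul_comat i j z z' : M1 z -> M1 z' ->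
  ract (z * z') (comat i (u j)) =
  \sum_l ract z (comat i (u l)) * ract z' (comat l (u j)).
Proof.
move=> hz hz'; rewrite ract_comat //; last exact: subalgM.
rewrite -!mulrA (mul_comat (hu j) hz') !mulr_sumr (frob_sum fr2) //.
apply: eq_bigr => l _.
by rewrite (ract_comat i (hu l) hz) -(frobMr fr2) // !mulrA.
Qed.

Lemma ract1_comat i j : ract 1 (comat i (u j)) = (i == j)%:R.
Proof. by rewrite ract_comat // mulr1 (cb_dual cb). Qed.

(* Writing [z o b] for [ract z b]: EM ((z' o P) (z o Q)) sums to
   EM ((z' z) o b) = ract 1 b * EM (z' z), and [EM_antip] moves P to the right
   factor as [antip P]. *)
Lemma convolution_antip m b (P Q : 'I_m -> T) : B b -> (forall l, B (P l)) ->
  (forall z z', M1 z -> M1 z' -> ract (z * z') b = \sum_l ract z (P l) * ract z' (Q l)) ->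
  \sum_l Q l * antip (P l) = ract 1 b.
Proof.
move=> hb hP PQ; apply: EM_ract_inj => z z' hz hz'.
rewrite -[ract 1 b]mulr1 (scalMl _ (ract1_scalar hb)) ractZ ract1 //.
rewrite ract_sumr mulr_sumr (frob_sum fr1) => [|j]; last exact: subalgM.
have hzz := subalgM hM1 hz' hz.
rewrite -scalerAr (frobZ fr1) // -(scalMl _ (ract1_scalar hb)) -EM_ract // PQ //.
rewrite (frob_sum fr1) => [|j]; last exact: subalgM.
by apply: eq_bigr => j _; rewrite -ractM -EM_antip.
Qed.

Lemma comat_antip b : B b -> \sum_j comat j b * antip (u j) = ract 1 b.
Proof. by move=> hb; apply: convolution_antip => // z z' hz hz'; apply: ract_mul. Qed.

Lemma comat_lincomb l (c : 'I_d -> k) :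
  comat l (\sum_j c j *: u j) = \sum_j c j *: comat l (u j).
Proof.
have hc : B (\sum_j c j *: u j) by apply: subalg_sum => // j; apply: subalgZ.
apply: ract_inj => z hz; rewrite ract_comat // ract_sumr mulr_sumr (frob_sum fr2) //.
by apply: eq_bigr => j _; rewrite ractZ ract_comat // -scalerAr (frobZ fr2).
Qed.

(* The matrix [comat i (u j)] has a one-sided inverse by [convolution_antip],
   which is two-sided since [B] is finite dimensional. *)
Lemma antip_comat b : B b -> \sum_j antip (comat j b) * u j = ract 1 b.
Proof.
(* The indices are transposed to match the order [Q l * antip (P l)] in [convolution_antip]. *)
pose C i l := comat l (u i); pose D l j := antip (comat j (u l)).
have hC i j : B (C i j) by apply: comat_in.
have hD i j : B (D i j) by apply/antip_in/comat_in.
have CD i j : \sum_l C i l * D l j = (i == j)%:R.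
  rewrite eq_sym -ract1_comat.
  apply: (convolution_antip (P := fun l => comat j (u l))) => [|l|z z' hz hz'].
  - exact: comat_in.
  - exact: comat_in.
  - exact: ract_mul_comat.
have DC := finite_dim_mulmx1C hB hu (cb_coordE fr2 cb)
  (cb_coordK fr2 cb) hC hD CD.
(* One counit law, obtained from [ract_mul] at the product [1 * z]. *)
have uE l : u l = \sum_i ract 1 (u i) * comat i (u l).
  apply: ract_inj => z hz; rewrite -{1}[z]mul1r ract_mul // ract_sumr.
  apply: eq_bigr => i _; have hs := ract1_scalar (hu i).
  by rewrite [in RHS](scalMl _ hs) [RHS]ractZ (scalMl _ hs).
(* Expanding the factor [u l] by the counit law brings in the entries of the product of [D] and [C],
   the identity matrix. *)
have basis j : \sum_l antip (comat l (u j)) * u l = ract 1 (u j).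
  transitivity (\sum_l \sum_i ract 1 (u i) * (D j l * C l i)).
    apply: eq_bigr => l _; rewrite [X in _ * X = _]uE mulr_sumr; apply: eq_bigr => i _.
    have hs := ract1_scalar (hu i).
    by rewrite mulrA -(scal_comm (antip _) hs) -mulrA.
  rewrite exchange_big (bigD1 j) //= -mulr_sumr DC eqxx mulr1 big1 ?addr0 // => i ni.
  by rewrite -mulr_sumr DC eq_sym (negbTE ni) mulr0.
move=> hb; rewrite (cb_coordE fr2 cb hb) ract_sumr.
transitivity (\sum_l \sum_j cb_coord EM1 v b 0 j *: (antip (comat l (u j)) * u l)).
  apply: eq_bigr => l _; rewrite comat_lincomb antip_sum ?mulr_suml => [|j].
    by apply: eq_bigr => j _; rewrite antipZ ?scalerAl //; apply: comat_in.
  by apply: subalgZ => //; apply: comat_in.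
by rewrite exchange_big; apply: eq_bigr => j _; rewrite -scaler_sumr basis ractZ.
Qed.

Lemma qpairM a a' b : A a -> A a' -> B b ->
  qpair (a * a') b = \sum_j qpair a (u j) * qpair a' (comat j b).
Proof.
move=> ha ha' hb; rewrite /qpair ract_mul //; try exact: A_M1.
rewrite {1}/epsA mulr_suml (frob_sum fr1) ?scaler_sumr => [|j]; last first.
  by apply: subalgM => //; apply: subalgM.
apply: eq_bigr => j _; rewrite -epsAM //; apply: ract_A => //; exact: comat_in.
Qed.

(** Acting by [b] and then by [b'] applies the product rule twice; this is multiplicativity of the
    coproduct in paired form. *)
Lemma qpairMM a a' b b' : A a -> A a' -> B b -> B b' ->
  qpair (a * a') (b * b') =
  \sum_i \sum_j qpair a (u i * u j) * qpair a' (comat i b * comat j b').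
Proof.
move=> ha ha' hb hb'.
transitivity (\sum_i qpair (ract a (u i) * ract a' (comat i b)) b').
  rewrite /qpair -ractM ract_mul //; try exact: A_M1.
  rewrite ract_suml /epsA mulr_suml (frob_sum fr1) ?scaler_sumr // => j.
  exact: subalgM.
apply: eq_bigr => i _; rewrite qpairM //; last first.
- by apply: ract_A => //; apply: comat_in.
- exact: ract_A.
by apply: eq_bigr => j _; rewrite /qpair !ractM.
Qed.

Lemma qpair1 b : B b -> qpair 1 b = ract 1 b.
Proof.
move=> hb; have hs := ract1_scalar hb; rewrite /qpair /epsA (scalMl _ hs) (frobZ fr1) //.
rewrite -[e1]mul1r -[1 * e1]mulr1 (bc_E1 hbc1) // mulr1 !scalerA mulrC mulrA.
by rewrite divff // mul1r scalE.
Qed.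

End Tower.

(** * Transport along the antipode and assembly of both Hopf algebras *)

Theorem theorem4p13 (k : fieldType) (T : algType k)
  (N M M1 : T -> Prop) (E EM EM1 : T -> T) (n : nat) (x y : 'I_n -> T)
  (lam : k) (e1 e2 : T)
  (hN : is_subalg N) (hM : is_subalg M) (hM1 : is_subalg M1)
  (hNM : forall z, N z -> M z) (hMM1 : forall z, M z -> M1 z)
  (hirr : forall m, centralizer M N m -> exists c : k, m = c%:A)
  (hEN : forall m, M m -> N (E m))
  (hEadd : forall m m', M m -> M m' -> E (m + m') = E m + E m')
  (hEbimod : forall a m b, N a -> M m -> N b -> E (a * m * b) = a * E m * b)
  (hxy_in : forall i, M (x i) /\ M (y i))
  (hqb : forall m, M m -> \sum_(i < n) E (m * x i) * y i = m /\
                          \sum_(i < n) x i * E (y i * m) = m)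
  (hE1 : E 1 = 1) (hlam : lam != 0)
  (hxy : \sum_(i < n) x i * y i = lam^-1%:A)
  (hbc1 : basic_construction N M M1 E lam e1 EM)
  (hbc2 : basic_construction M M1 (fun _ => True) EM lam e2 EM1)
  (hd2A : right_free_basis_in M M1 (centralizer M1 N))
  (hd2B : right_free_basis_in M1 (fun _ => True)
            (centralizer (fun _ => True) M)) :
  let A := centralizer M1 N in
  let B := centralizer (fun _ => True) M in
  let pr := pairing lam EM EM1 e1 e2 in
  exists (DB : T -> seq (T * T)) (epsB : T -> k) (SB : T -> T)
         (DA : T -> seq (T * T)) (epsA : T -> k) (SA : T -> T),
  (* defining properties of the structure maps on B *)
      (forall b, B b -> forall a a', A a -> A a' ->
          \sum_(p <- DB b) pr a p.1 * pr a' p.2 = pr (a * a') b) /\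
      (forall b, B b -> (epsB b)%:A = pr 1 b) /\
      (forall b, B b -> B (SB b) /\ EM1 (b * e1 * e2) = EM1 (e2 * e1 * SB b)) /\
      (* defining properties of the structure maps on A *)
      (forall a, A a -> forall b b', B b -> B b' ->
          \sum_(p <- DA a) pr p.1 b * pr p.2 b' = pr a (b * b')) /\
      (forall a, A a -> (epsA a)%:A = pr a 1) /\
      (forall a, A a -> A (SA a) /\ forall b, B b -> pr (SA a) b = pr a (SB b)) /\
      (* conclusions *)
      is_hopf B DB epsB SB /\ semisimple_alg B /\
      is_hopf A DA epsA SA /\ semisimple_alg A /\
    (* the pairing is non-degenerate, hence A is the dual Hopf algebra of B *)
      (forall a, A a -> (forall b, B b -> pr a b = 0) -> a = 0) /\
      (forall b, B b -> (forall a, A a -> pr a b = 0) -> b = 0).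
Proof.
move=> A B pr.
have fr0 : frobenius N M E lam x y.
  by split=> // [i|i|r hr|r hr]; [case: (hxy_in i)|case: (hxy_in i)|case: (hqb r hr)|case: (hqb r hr)].
have full := subalg_full T.
have fr1 := bc_frobenius fr0 hlam hM1 hMM1 hbc1.
have fr2 := bc_frobenius fr1 hlam full (fun _ _ => I) hbc2.
have irr1 := bc_irreducible fr0 hlam hM1 hMM1 hbc1 hirr.
have hA : is_subalg A := centralizer_subalg N hM1.
have hB : is_subalg B := centralizer_subalg M full.
have [dA [ua [va cbA]]] := frob_centralizer_basis fr1 hNM hirr hd2A.
have [dB [u [v cbB]]] := frob_centralizer_basis fr2 hMM1 irr1 hd2B.
have hu j : B (u j) := cb_u cbB j.
have A1 := subalg1 hA; have B1 := subalg1 hB.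
have AM1 a : A a -> M1 a by case.
pose S := antip EM1 x y lam e1 e2.
pose s := antip_inv EM1 x y lam e1 e2.
pose q := qpair EM EM1 lam e1 e2.
pose r := ract EM1 lam e2.
pose w := comat EM1 x y lam e1 e2 v.
have S_in b : B b -> B (S b) by apply: (antip_in fr0 hlam hM1 hMM1 hbc1 hbc2).
have s_in b : B b -> B (s b) by apply: (antip_inv_in fr0 hlam hM1 hMM1 hbc1 hbc2).
have w_in j b : B b -> B (w j b) by apply: (comat_in fr0 hlam hM1 hMM1 hbc1 hbc2 cbB).
have sK b : B b -> S (s b) = b by apply: (antip_invK fr0 hlam hM1 hMM1 hbc1 hbc2).
have SL c b b' : B b -> B b' -> S (c *: b + b') = c *: S b + S b'.
  exact: (antipL fr0 hlam hM1 hMM1 hbc1 hbc2).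
have SM b b' : B b -> B b' -> S (b * b') = S b' * S b.
  exact: (antipM fr0 hlam hM1 hMM1 hbc1 hbc2).
have S1 : S 1 = 1 by apply: (antip1 fr0 hlam hM1 hMM1 hbc1 hbc2).
have pS a b : A a -> B b -> pr a (S b) = q a b.
  exact: (pairing_antip fr0 hlam hM1 hMM1 hbc1 hbc2).
have p_scal a b : A a -> B b -> is_scalar (pr a b).
  exact: (pairing_scalar fr0 hlam hM1 hMM1 hirr hbc1 hbc2).
pose p a b := scal (pr a b).
have pE a b : A a -> B b -> (p a b)%:A = pr a b by move=> ha hb; apply/scalE/p_scal.
have prE a b : A a -> pr a b = lam^-1 *: EM (a * r e1 b).
  by move=> ha; apply: (pairingE fr0 hlam hM1 hMM1 hbc1 hbc2); apply: AM1.
have hr z b : M1 (r z b) by apply: (ract_in fr0 hlam hM1 hMM1 hbc1 hbc2).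
have rA b : B b -> A (r e1 b).
  apply: (ract_A fr0 hlam hM1 hMM1 hbc1 hbc2); exact: (A_e1 hbc1).
have EMl c z z' : M1 z -> M1 z' -> EM (c *: z + z') = c *: EM z + EM z'.
  exact: (frobL fr1).
have prLl c a a' b : A a -> A a' -> B b -> pr (c *: a + a') b = c *: pr a b + pr a' b.
  move=> ha ha' hb; rewrite !prE //; last exact: subalgL.
  rewrite mulrDl -scalerAl EMl; try by apply: subalgM => //; apply: AM1.
  by rewrite scalerDr !scalerA (mulrC c).
have prLr c a b b' : A a -> B b -> B b' -> pr a (c *: b + b') = c *: pr a b + pr a b'.
  move=> ha hb hb'; rewrite !prE //.
  rewrite /r (ractLr fr0 hlam hM1 hMM1 hbc1 hbc2) -/r mulrDr -scalerAr.
  rewrite EMl; try by apply: subalgM => //; apply: AM1.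
  by rewrite scalerDr !scalerA (mulrC c).
have pLl c a a' b : A a -> A a' -> B b -> p (c *: a + a') b = c * p a b + p a' b.
  by move=> ha ha' hb; rewrite /p prLl // scalP //; apply: p_scal.
have pLr c a b b' : A a -> B b -> B b' -> p a (c *: b + b') = c * p a b + p a b'.
  by move=> ha hb hb'; rewrite /p prLr // scalP //; apply: p_scal.
have qM a a' b : A a -> A a' -> B b ->
    q (a * a') b = \sum_j q a (u j) * q a' (w j b).
  exact: (qpairM fr0 hlam hM1 hMM1 hirr hbc1 hbc2 cbB).
have qMM a a' b b' : A a -> A a' -> B b -> B b' -> q (a * a') (b * b') =
    \sum_i \sum_j q a (u i * u j) * q a' (w i b * w j b').
  exact: (qpairMM fr0 hlam hM1 hMM1 hirr hbc1 hbc2 cbB).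
have q1 b : B b -> q 1 b = r 1 b.
  exact: (qpair1 fr0 hlam hM1 hMM1 hirr hbc1 hbc2).
have w_antip b : B b -> \sum_j w j b * S (u j) = r 1 b.
  exact: (comat_antip fr0 hlam hM1 hMM1 hirr hbc1 hbc2 cbB).
have antip_w b : B b -> \sum_j S (w j b) * u j = r 1 b.
  exact: (antip_comat fr0 hlam hM1 hMM1 hirr hbc1 hbc2 cbB).
have r1 z (hz : M1 z) : r z 1 = z := ract1 hlam hM1 hbc2 hz.
have q_scal a b : A a -> B b -> is_scalar (q a b).
  by move=> ha hb; rewrite -pS //; apply/p_scal/S_in.
(* Frobenius dual bases (ua, va) of A for EM give dual bases (va, be) of the pairing,
   since the pairing of a with ract_inv a' is lam^-1 EM (a a'). *)
pose be i := ract_inv x y lam e1 e2 (lam *: ua i).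
have hua i : A (ua i) := cb_u cbA i; have hva i : A (va i) := cb_v cbA i.
have be_in i : B (be i).
  by apply: (ract_inv_in fr0 hbc1 hbc2); apply: (subalgZ hA).
have r_be i : r e1 (be i) = lam *: ua i.
  by apply: (ract_invK fr0 hlam hM1 hMM1 hbc1 hbc2); apply: (subalgZ hA).
have expandB b : B b -> \sum_i p (va i) b *: be i = b.
  move=> hb; apply: (ract_e1_inj fr0 hlam hM1 hMM1 hbc1 hbc2) => //.
    by apply: (subalg_sum hB) => i; apply: (subalgZ hB).
  rewrite (ract_sumr fr0 hlam hM1 hMM1 hbc1 hbc2).
  rewrite -[RHS](cb_l cbA); last exact: hr.
  apply: eq_bigr => i _; rewrite (ractZ fr0 hlam hM1 hMM1 hbc1 hbc2) -/r r_be.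
  have -> : EM (va i * r e1 b) = lam *: pr (va i) b.
    by rewrite prE // scalerA divff // scale1r.
  by rewrite -scalerAr (scalMr _ (p_scal _ _ (hva i) hb)) !scalerA mulrC.
have expandA a : A a -> \sum_i p a (be i) *: va i = a.
  move=> ha; rewrite -[RHS](cb_r cbA) //; apply: eq_bigr => i _.
  rewrite /p prE // r_be -scalerAr (frobZ fr1); last by apply: (subalgM hM1); apply: AM1.
  rewrite scalerA mulVf // scale1r scalMl //.
  by apply: (cb_scalar cbA); apply: (subalgM hA).
(* Since [b = S (s b)] and [pr a (S b) = q a b], the coproduct adapted to [q] becomes one adapted to
   [pr] by applying [S] to both legs. *)
pose DB b := [seq (S (u j), S (w j (s b))) | j <- enum 'I_dB].
have DB_in b : B b -> forall t, t \in DB b -> B t.1 /\ B t.2.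
  by move=> hb t /mapP [j _ ->] /=; split; auto.
have pSE a b : A a -> B b -> p a (S b) = scal (q a b).
  by move=> ha hb; rewrite /p pS.
have scal_sum (I : Type) (l : seq I) (F : I -> T) : (forall i, is_scalar (F i)) ->
    scal (\sum_(i <- l) F i) = \sum_(i <- l) scal (F i).
  move=> hF; apply: (@scalar_inj _ T); rewrite scaler_suml.
  under [RHS]eq_bigr => i _ do rewrite scalE //.
  apply: scalE; elim/big_ind: _ => //; first by exists 0; rewrite scale0r.
  by move=> _ _ [c ->] [c' ->]; exists (c + c'); rewrite scalerDl.
have M_scal z z' : is_scalar z -> is_scalar z' -> is_scalar (z * z').
  by move=> hz hz'; rewrite scalMl //; apply: is_scalarZ.
have DBp b : B b -> forall a a', A a -> A a' ->
    \sum_(t <- DB b) p a t.1 * p a' t.2 = p (a * a') b.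
  move=> hb a a' ha ha'; rewrite -[in RHS](sK b) // pSE; try by [apply: subalgM|auto].
  rewrite qM //; last exact: s_in.
  rewrite scal_sum => [|j]; last by apply: M_scal; apply: q_scal; auto.
  rewrite big_map big_enum; apply: eq_bigr => j _ /=.
  by rewrite !pSE ?scalM //; auto; apply: q_scal; auto.
have DBmul b b' : B b -> B b' -> forall a a', A a -> A a' ->
    \sum_(t <- DB b) \sum_(t' <- DB b') p a (t.1 * t'.1) * p a' (t.2 * t'.2) =
    p (a * a') (b * b').
  move=> hb hb' a a' ha ha'.
  (* [S] reverses products, so [s b'] and [s b] appear exchanged; the two sums are swapped
     accordingly below. *)
  have -> : b * b' = S (s b' * s b) by rewrite SM ?sK //; auto.
  rewrite pSE; try by [apply: subalgM|apply: subalgM; auto].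
  rewrite qMM //; try exact: s_in.
  have huu i j : B (u i * u j) by apply: subalgM.
  have hww i j : B (w i (s b') * w j (s b)) by apply: subalgM; auto.
  have scal_qq i j : is_scalar (q a (u i * u j) * q a' (w i (s b') * w j (s b))).
    by apply: M_scal; apply: q_scal.
  transitivity (\sum_i \sum_j scal (q a (u i * u j) * q a' (w i (s b') * w j (s b)))).
    rewrite exchange_big big_map big_enum; apply: eq_bigr => j _ /=.
    rewrite big_map big_enum; apply: eq_bigr => i _ /=.
    by rewrite -!SM ?pSE ?scalM //; auto.
  rewrite scal_sum => [|i]; first by apply: eq_bigr => i _; rewrite scal_sum.
  elim/big_ind: _ => //; first by exists 0; rewrite scale0r.
  by move=> _ _ [c ->] [c' ->]; exists (c + c'); rewrite scalerDl.
have r1_scal b : B b -> is_scalar (r 1 b).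
  exact: (ract1_scalar fr0 hlam hM1 hMM1 hirr hbc1 hbc2).
have pr1 b : B b -> pr 1 b = r 1 (s b).
  by move=> hb; have hs := s_in _ hb; rewrite -{1}(sK b hb) pS // q1.
have S_scal z : is_scalar z -> S z = z.
  move=> [c ->]; have B0 := subalg0 hB.
  by rewrite /S (antipZ fr0 hlam hM1 hMM1 hbc1 hbc2) // -/S S1.
have Ssum (F : 'I_dB -> T) : (forall j, B (F j)) -> S (\sum_j F j) = \sum_j S (F j).
  exact: (antip_sum fr0 hlam hM1 hMM1 hbc1 hbc2).
(* [S t.1 * t.2] is [S] of [w j (s b) * S (u j)], so this law comes from [w_antip], and likewise
   [Sr] from [antip_w]; [S] fixes the scalar value. *)
have Sl b : B b -> \sum_(t <- DB b) S t.1 * t.2 = (p 1 b)%:A.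
  move=> hb; rewrite pE // pr1 // -[RHS]S_scal; last by auto.
  rewrite -w_antip ?Ssum => [|j|]; [|by apply: (subalgM hB); auto|exact: s_in].
  by rewrite big_map big_enum; apply: eq_bigr => j _ /=; rewrite SM //; auto.
have Sr b : B b -> \sum_(t <- DB b) t.1 * S t.2 = (p 1 b)%:A.
  move=> hb; rewrite pE // pr1 // -[RHS]S_scal; last by auto.
  rewrite -antip_w ?Ssum => [|j|]; [|by apply: (subalgM hB); auto|exact: s_in].
  by rewrite big_map big_enum; apply: eq_bigr => j _ /=; rewrite SM //; auto.
have pa1 a : A a -> pr a 1 = epsA EM lam e1 a.
  move=> ha; rewrite -S1 pS // /q /qpair -/r r1 //; exact: AM1.
have p11 : p 1 1 = 1.
  apply: (@scalar_inj _ T); rewrite pE // scale1r -[X in pr _ X]S1 pS // q1 // r1 //; exact: AM1.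
have pM1 a a' : A a -> A a' -> p (a * a') 1 = p a 1 * p a' 1.
  move=> ha ha'; rewrite -scalM; try exact: p_scal.
  rewrite /p !pa1 //; last exact: subalgM.
  by rewrite (epsAM fr0 hlam hM1 hMM1 hirr hbc1).
(* On values of [S] the map [pr 1] becomes [r 1], which is multiplicative because [r 1 (s b')] is a
   scalar and comes out of the action of [s b]. *)
have p1M b b' : B b -> B b' -> p 1 (b * b') = p 1 b * p 1 b'.
  move=> hb hb'; apply: (@scalar_inj _ T).
  have hs := s_in _ hb; have hs' := s_in _ hb'; have hss := subalgM hB hs' hs.
  have -> : b * b' = S (s b' * s b) by rewrite SM ?sK.
  have pr1S c : B c -> pr 1 (S c) = r 1 c.
    by move=> hc; rewrite pS // q1.
  have [c hc] := r1_scal _ hs'.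
  have -> : p 1 b' = c by rewrite /p pr1 // hc scalK.
  rewrite mulrC -scalerA !pE ?pr1S ?pr1 //; last exact: S_in.
  rewrite /r -(ractM fr0 hlam hM1 hMM1 hbc1 hbc2) -/r hc -[c%:A]mulr1.
  rewrite /r (ractMl fr0 hlam hM1 hMM1 hbc1 hbc2) //; last exact: (subalgA hM).
  by rewrite -scalerAl mul1r.
have DAp a : A a -> forall b b', B b -> B b' ->
    \sum_(t <- dual_comul p va be a) p t.1 b * p t.2 b' = p a (b * b').
  by move=> ha b b' hb hb'; apply: (dual_comulP hA hB hva be_in pLl pLr expandB).
have SAp a b : A a -> B b -> p (dual_antipode p va be S a) b = p a (S b).
  by move=> ha hb; apply: (dual_antipodeP hA hB hva be_in pLl pLr expandB S_in SL).
have mul_scal c c' : c%:A * c'%:A = (c * c')%:A :> T.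
  by rewrite -scalerAl mul1r scalerA.
exists DB, (p 1), S, (dual_comul p va be), (p^~ 1), (dual_antipode p va be S).
split.
  move=> b hb a a' ha ha'; rewrite -pE //; last exact: subalgM.
  rewrite -DBp // scaler_suml; apply: eq_big_seq => t /(DB_in _ hb) [t1 t2].
  by rewrite -!pE // mul_scal.
split; first by move=> b hb; apply: pE.
split.
  move=> b hb; split; first exact: S_in.
  (* Scaling by [lam] removes the normalization of [lact] and [ract] and leaves the relation that
     defines the antipode. *)
  have := ract_antip_e1 fr0 hlam hM1 hMM1 hbc1 hbc2 hb.
  move/(congr1 (fun z => lam *: z)); rewrite !scalerA divff // !scale1r.
  by move=> ->.
split.
  move=> a ha b b' hb hb'; rewrite -pE //; last exact: subalgM.
  rewrite -DAp // scaler_suml; apply: eq_big_seq => t.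
  move=> /(dual_comul_in hA hva) [t1 t2].
  by rewrite -!pE // mul_scal.
split; first by move=> a ha; apply: pE.
split.
  move=> a ha; have hSa : A (dual_antipode p va be S a) by apply: dual_antipode_in.
  split=> // b hb; rewrite -!pE ?SAp //; exact: S_in.
split; first exact: (hopf_of_pairing hA hB hva be_in pLr expandB DB_in DBp).
split; first exact: (cb_semisimple hlam fr2 cbB).
split; first exact: (dual_hopf hA hB hva be_in pLl pLr expandB expandA DB_in DBp).
split; first exact: (cb_semisimple hlam fr1 cbA).
have p0 : scal (0 : T) = 0 by rewrite -(scale0r 1) scalK.
split=> [a ha a0|b hb b0].
  by rewrite -(expandA a ha) big1 // => i _; rewrite /p a0 // p0 scale0r.
by rewrite -(expandB b hb) big1 // => i _; rewrite /p b0 // p0 scale0r.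
Qed.
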